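(* Let $X$ be a compact, connected, oriented Riemannian surface and let $F$ be an $SO(2)$ vector bundle of rank $2$ over $X$. There exists an isomorphism of real vector bundles $\Phi:F\oplus F^3\to \mathrm{Hom}(F^*,S^2_0F)$ such that, if for $v\in F_x$ and $w\in F_x^3$ we let $\sigma=\Phi(v\oplus w)$, then the endomorphism $G_\sigma:F_x^*\to F_x^*$ defined by $$\langle G_\sigma\xi,\eta\rangle=g(\sigma(\xi),\sigma(\eta))$$ has eigenvalues $$\kappa_1=\tfrac12(|v|-|w|)^2,\qquad \kappa_2=\tfrac12(|v|+|w|)^2.$$ Furthermore, for $v\neq0$ and $w\neq0$ the eigenspaces $L_1$ and $L_2$ corresponding to $\kappa_1$ and $\kappa_2$ are $$L_1=\mathbb R\cdot\{z^\flat\in F_x^*\mid z^2=w/v\},\qquad L_2=\mathbb R\cdot\{z^\flat\in F_x^*\mid z^2=-w/v\}.$$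
   Context: $F$ is a real rank 2 bundle with fibre metric and orientation, so (as $SO(2)=U(1)$) it is also a complex line bundle with Hermitian norm. For $n>0$, $F^n$ is the $n$-fold complex tensor power of $F$, with induced norm satisfying $|ab|=|a||b|$ (products are tensor products); $F^{-n}$ is the $n$-th power of the conjugate bundle, and $F^0=X\times\mathbb C$. For $0\ne v\in F_x$, $v^{-1}\in F_x^{-1}$ is the element with $vv^{-1}=1$, and $w/v=wv^{-1}\in F^2_x$ for $w\in F_x^3$; for $z\in F_x$, $z^2=z\otimes_{\mathbb C}z\in F_x^2$. $F^*$ is the real dual of $F$ with the induced metric $\langle\cdot,\cdot\rangle$, and $z\mapsto z^\flat=\langle z,\cdot\rangle$ is the metric isomorphism $F\to F^*$. $S^2_0F$ is the bundle of traceless endomorphisms of the fibres of $F$ that are symmetric for the metric, with metric $g(A,B)=\frac12\mathrm{tr}(A\circ B)$. $\mathrm{Hom}(F^*,S_0^2F)$ is the bundle of real linear homomorphisms. For a set $A$ of vectors, $\mathbb R\cdot A$ is the set of real multiples of elements of $A$. *)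

(* Defs.v *)
From HB Require Import structures.
From mathcomp Require Import all_boot all_order all_algebra.
From mathcomp.real_closed Require Import complex.
From mathcomp Require Import all_classical all_reals all_analysis.

Set Implicit Arguments.
Unset Strict Implicit.
Unset Printing Implicit Defensive.

Import Order.TTheory GRing.Theory Num.Theory.
Import numFieldNormedType.Exports.

Local Open Scope classical_set_scope.
Local Open Scope ring_scope.
Local Open Scope complex_scope.

Fixpoint Ck (R : realType) (k : nat) (U : set 'rV[R]_2)
    (f : 'rV[R]_2 -> R) : Prop :=
  (forall p, U p -> {for p, continuous f}) /\
  if k is k'.+1 then
    forall i : 'I_2,
      (forall p, U p -> derivable f p (delta_mx 0 i)) /\
      Ck k' U (fun p => 'D_(delta_mx 0 i) f p)
  else True.

Definition smooth (R : realType) (U : set 'rV[R]_2) (f : 'rV[R]_2 -> R) :=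
  forall k, Ck k U f.

(* The values of [cmap] outside [cdom], and of [cinv] outside the image of
   [cdom], are irrelevant. *)
Record chart (R : realType) (X : topologicalType) := Chart {
  cdom : set X;
  cmap : X -> 'rV[R]_2;
  cinv : 'rV[R]_2 -> X }.

Definition is_chart (R : realType) (X : topologicalType) (c : chart R X) :=
  [/\ open (cdom c),
      open (cmap c @` cdom c),
      forall x, cdom c x -> cinv c (cmap c x) = x,
      forall x, cdom c x -> {for x, continuous (cmap c)}
    & forall p, (cmap c @` cdom c) p -> {for p, continuous (cinv c)}].

Definition overlap (R : realType) (X : topologicalType) (c c' : chart R X) :=
  cmap c @` (cdom c `&` cdom c').

Definition transition (R : realType) (X : topologicalType) (c c' : chart R X)
  : 'rV[R]_2 -> 'rV[R]_2 := cmap c' \o cinv c.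

Definition jacobian (R : realType) (f : 'rV[R]_2 -> 'rV[R]_2) (p : 'rV[R]_2)
  : 'M[R]_2 := \matrix_(i, j) 'D_(delta_mx 0 i) (fun q => f q 0 j) p.

(* The orientation is given by an atlas whose transition maps have positive
   Jacobian determinant, the Riemannian metric by its Gram matrix in each
   chart. *)
Record riemannian_surface (R : realType) (X : topologicalType) := RSurface {
  atlas : set (chart R X);
  gram : chart R X -> 'rV[R]_2 -> 'M[R]_2;
  surface_hausdorff : hausdorff_space X;
  atlas_chart : forall c, atlas c -> is_chart c;
  atlas_cover : forall x, exists2 c, atlas c & cdom c x;
  atlas_smooth : forall c c' j, atlas c -> atlas c' ->
    smooth (overlap c c') (fun p => transition c c' p 0 j);
  atlas_oriented : forall c c' p, atlas c -> atlas c' -> overlap c c' p ->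
    0 < \det (jacobian (transition c c') p);
  gram_smooth : forall c i j, atlas c ->
    smooth (cmap c @` cdom c) (fun p => gram c p i j);
  gram_sym : forall c p, atlas c -> (cmap c @` cdom c) p ->
    (gram c p)^T = gram c p;
  gram_pos : forall c p (u : 'rV[R]_2), atlas c -> (cmap c @` cdom c) p ->
    u != 0 -> 0 < (u *m gram c p *m u^T) 0 0;
  gram_transition : forall c c' p, atlas c -> atlas c' -> overlap c c' p ->
    let J := jacobian (transition c c') p in
    gram c p = J *m gram c' (transition c c' p) *m J^T }.

Definition smooth_fun (R : realType) (X : topologicalType)
    (S : riemannian_surface R X) (U : set X) (f : X -> R) :=
  forall c, atlas S c -> smooth (cmap c @` (cdom c `&` U)) (f \o cinv c).

Definition smooth_cfun (R : realType) (X : topologicalType)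
    (S : riemannian_surface R X) (U : set X) (f : X -> R[i]) :=
  smooth_fun S U (fun x => complex.Re (f x)) /\
  smooth_fun S U (fun x => complex.Im (f x)).

Definition inner_product (R : realType) (V : vectType R) (ip : V -> V -> R) :=
  [/\ forall a u v w, ip (a *: u + v) w = a * ip u w + ip v w,
      forall u v, ip u v = ip v u
    & forall u, u != 0 -> 0 < ip u u].

Definition norm (R : realType) (V : vectType R) (ip : V -> V -> R) (v : V) : R :=
  Num.sqrt (ip v v).

Definition flat (R : realType) (V : vectType R) (ip : V -> V -> R) (z : V)
  : 'Hom(V, R^o) := linfun (fun u => ip z u : R^o).

Definition sharp (R : realType) (V : vectType R) (ip : V -> V -> R)
  : 'Hom('Hom(V, R^o), V) := (linfun (flat ip))^-1%VF.

Definition dual_ip (R : realType) (V : vectType R) (ip : V -> V -> R)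
  (xi eta : 'Hom(V, R^o)) : R := ip (sharp ip xi) (sharp ip eta).

Definition trace (R : realType) (V : vectType R) (A : 'End(V)) : R^o :=
  \tr (passmx.mxof (vbasis {:V}) (vbasis {:V}) A).

Definition adjoint (R : realType) (V : vectType R) (ip : V -> V -> R)
  (A : 'End(V)) : 'End(V) :=
  linfun (fun u => sharp ip (flat ip u \o A)%VF).

(* The traceless A with A = adjoint A; see [mem_S20]. *)
Definition S20 (R : realType) (V : vectType R) (ip : V -> V -> R)
  : {vspace 'End(V)} :=
  (lker (linfun (@trace R V)) :&:
   lker (linfun (fun A : 'End(V) => A - adjoint ip A)))%VS.

Definition S20_ip (R : realType) (V : vectType R) (ip : V -> V -> R)
  (A B : subvs_of (S20 ip)) : R := 2^-1 * trace (vsval A \o vsval B)%VF.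

(* G is unique since [dual_ip] is nondegenerate; it exists by [Gop_def]. *)
Definition Gop (R : realType) (V : vectType R) (ip : V -> V -> R)
  (sigma : 'Hom('Hom(V, R^o), subvs_of (S20 ip))) : 'End('Hom(V, R^o)) :=
  xget 0 [set G : 'End('Hom(V, R^o)) | forall xi eta,
            dual_ip ip (G xi) eta = S20_ip (sigma xi) (sigma eta)].

Definition real_multiples (R : realType) (V : lmodType R) (A : set V) : set V :=
  [set y | exists c : R, exists2 a, A a & y = c *: a].

Section FlatSharp.
Context (R : realType) (V : vectType R) (ip : V -> V -> R).
Hypothesis ipP : inner_product ip.

Let ipZD a u v w : ip (a *: u + v) w = a * ip u w + ip v w.
Proof. by case: ipP. Qed.
Let ipC u v : ip u v = ip v u.
Proof. by case: ipP. Qed.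

Let ipr_linear z : linear (fun u => ip z u : R^o).
Proof. by move=> a u v; rewrite ![ip z _]ipC ipZD. Qed.

Lemma flatE z u : flat ip z u = ip z u.
Proof.
pose L := GRing.isLinear.Build R V R^o *:%R _ (ipr_linear z).
pose f : {linear V -> R^o} := HB.pack (fun u => ip z u : R^o) L.
exact: (lfunE f u).
Qed.

Let flat_linear : linear (flat ip).
Proof.
move=> a u v; apply/lfunP => w.
by rewrite add_lfunE scale_lfunE !flatE ipZD.
Qed.

Let flatlE z : linfun (flat ip) z = flat ip z.
Proof.
pose L := GRing.isLinear.Build R V 'Hom(V, R^o) *:%R _ flat_linear.
pose f : {linear V -> 'Hom(V, R^o)} := HB.pack (flat ip) L.
exact: (lfunE f z).
Qed.

Let flat_ker : lker (linfun (flat ip)) == 0%VS.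
Proof.
apply/lker0P => u v; rewrite !flatlE => /lfunP uv.
apply/eqP; rewrite -subr_eq0; apply/negPn/negP => nz.
have [_ _ /(_ _ nz)] := ipP.
rewrite -{1}[u - v]/(u + - v) -[- v]scaleN1r addrC ipZD.
by have := uv (-1 *: v + u); rewrite !flatE => ->; rewrite mulN1r addNr ltxx.
Qed.

Lemma sharpK : cancel (flat ip) (sharp ip).
Proof. by move=> z; rewrite -flatlE /sharp lker0_lfunK. Qed.

Lemma flatK : cancel (sharp ip) (flat ip).
Proof.
move=> xi; rewrite -flatlE /sharp limg_lfunVK //.
suff -> : limg (linfun (flat ip)) = fullv by rewrite memvf.
apply/eqP; rewrite eqEdim subvf /= limg_dim_eq; last first.
  by rewrite (eqP flat_ker) capv0.
by rewrite !dimvf /dim /= muln1.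
Qed.

Lemma adjointE A u v : ip (adjoint ip A u) v = ip u (A v).
Proof.
have lin : linear (fun u => sharp ip (flat ip u \o A)%VF).
  move=> a s t; rewrite -linearP; congr (sharp ip _).
  by rewrite flat_linear comp_lfunDl comp_lfunZl.
pose L := GRing.isLinear.Build R V V *:%R _ lin.
pose f : {linear V -> V} := HB.pack (fun u => sharp ip (flat ip u \o A)%VF) L.
by rewrite /adjoint (lfunE f u) /= -flatE flatK comp_lfunE /= flatE.
Qed.

Lemma ip_inj u v : (forall w, ip u w = ip v w) -> u = v.
Proof.
move=> uv; rewrite -[u]sharpK -[v]sharpK; congr (sharp ip _).
by apply/lfunP => w; rewrite !flatE.
Qed.

Let trace_linear : linear (@trace R V).
Proof. by move=> a A B; rewrite /trace passmx.mxof_linear mxtraceD mxtraceZ. Qed.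

Let antisym_linear : linear (fun A : 'End(V) => A - adjoint ip A).
Proof.
suff adj : linear (adjoint ip).
  by move=> a A B; rewrite adj scalerBr opprD addrACA.
move=> a A B; apply/lfunP => u; apply: ip_inj => v.
rewrite add_lfunE scale_lfunE ipZD !adjointE.
by rewrite add_lfunE scale_lfunE ipC ipZD ![ip _ u]ipC.
Qed.

Lemma mem_S20 (A : 'End(V)) :
  A \in S20 ip <-> trace A = 0 /\ forall u v, ip (A u) v = ip u (A v).
Proof.
pose f : {linear 'End(V) -> R^o} := HB.pack (@trace R V)
  (GRing.isLinear.Build R 'End(V) R^o *:%R _ trace_linear).
pose g : {linear 'End(V) -> 'End(V)} := HB.pack
  (fun A : 'End(V) => A - adjoint ip A)
  (GRing.isLinear.Build R 'End(V) 'End(V) *:%R _ antisym_linear).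
rewrite /S20 memv_cap !memv_ker (lfunE f) (lfunE g) /= subr_eq0.
split=> [/andP[/eqP -> /eqP AA]|[-> AA]].
  by split=> // u v; rewrite {1}AA adjointE.
rewrite eqxx; apply/eqP/lfunP => u.
by apply: ip_inj => v; rewrite adjointE.
Qed.

Lemma Gop_def (sigma : 'Hom('Hom(V, R^o), subvs_of (S20 ip))) xi eta :
  dual_ip ip (Gop sigma xi) eta = S20_ip (sigma xi) (sigma eta).
Proof.
rewrite /Gop; case: xgetP => [G _ /= -> //|/(_ _) noG]; exfalso.
pose b xi u : R^o := S20_ip (sigma xi) (sigma (flat ip u)).
have b_lin z : linear (b z).
  move=> a s t; rewrite /b /S20_ip flat_linear !linearP /= comp_lfunDr.
  by rewrite -comp_lfunZr trace_linear mulrDr mulrCA.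
pose bl z : {linear V -> R^o} := HB.pack (b z)
  (GRing.isLinear.Build R V R^o *:%R _ (b_lin z)).
have g_lin : linear (fun z => linfun (bl z)).
  move=> a s t; apply/lfunP => u; rewrite add_lfunE scale_lfunE !lfunE /=.
  rewrite /b /S20_ip !linearP /= comp_lfunDl -comp_lfunZl trace_linear.
  by rewrite mulrDr mulrCA.
pose g : {linear 'Hom(V, R^o) -> 'Hom(V, R^o)} :=
  HB.pack (fun z => linfun (bl z))
  (GRing.isLinear.Build R 'Hom(V, R^o) 'Hom(V, R^o) *:%R _ g_lin).
apply: (noG (linfun g)) => z e /=.
by rewrite /dual_ip -flatE flatK (lfunE g) /= (lfunE (bl z)) /= /b flatK.
Qed.

End FlatSharp.

(* [pos u v] means that (u, v) is a positively oriented basis. *)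
Definition rot90 (R : realType) (V : vectType R) (ip : V -> V -> R)
    (pos : V -> V -> Prop) (v : V) : V :=
  xget 0 [set u | [/\ ip u u = ip v v, ip v u = 0 & v != 0 -> pos v u]].

(* From here on, [J] is the multiplication by i on V. *)

Definition cscale (R : realType) (V : vectType R) (J : V -> V) (c : R[i])
  (v : V) : V := complex.Re c *: v + complex.Im c *: J v.

Definition clinear (R : realType) (V : vectType R) (J : V -> V)
    (f : V -> R[i]) : Prop :=
  (forall u v, f (u + v) = f u + f v) /\
  (forall c v, f (cscale J c v) = c * f v).

Definition clinear_pred (R : realType) (V : vectType R) (J : V -> V)
  : pred (V -> R[i]) := fun f => `[< clinear J f >].

Record cdual (R : realType) (V : vectType R) (J : V -> V) :=
  CDual { cdual_val :> V -> R[i]; cdualP : clinear_pred J cdual_val }.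

HB.instance Definition _ (R : realType) (V : vectType R) (J : V -> V) :=
  [isSub for @cdual_val R V J].
HB.instance Definition _ (R : realType) (V : vectType R) (J : V -> V) :=
  [Choice of cdual J by <:].

Lemma clinear_submod (R : realType) (V : vectType R) (J : V -> V) :
  submod_closed (clinear_pred J).
Proof.
split=> [|c f g /asboolP[fD fZ] /asboolP[gD gZ]]; apply/asboolP; split.
- by move=> u v; rewrite addr0.
- by move=> c v; rewrite mulr0.
- by move=> u v; rewrite !fctE fD gD scalerDr addrACA.
- by move=> a v; rewrite !fctE fZ gZ mulrDr; congr (_ + _); exact: mulrCA.
Qed.

HB.instance Definition _ (R : realType) (V : vectType R) (J : V -> V) :=
  GRing.isSubmodClosed.Build R[i] (V -> R[i]) (clinear_pred J)
    (clinear_submod J).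
HB.instance Definition _ (R : realType) (V : vectType R) (J : V -> V) :=
  [SubChoice_isSubLmodule of cdual J by <:].

Definition upd (T : Type) (n : nat) (a : 'I_n -> T) (i : 'I_n) (b : T)
  : 'I_n -> T := fun j => if j == i then b else a j.

Definition cmultilinear (R : realType) (V : vectType R) (J : V -> V) (n : nat)
    (T : ('I_n -> cdual J) -> R[i]) : Prop :=
  forall (al : 'I_n -> cdual J) (i : 'I_n) (c : R[i]) (a b : cdual J),
    T (upd al i (c *: a + b)) = c * T (upd al i a) + T (upd al i b).

(* [Rcomplex R] is R[i] seen as a real vector space. *)
Definition cmultilinear_pred (R : realType) (V : vectType R) (J : V -> V)
  (n : nat) : pred (('I_n -> cdual J) -> Rcomplex R) :=
  fun T => `[< @cmultilinear R V J n T >].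

(* The n-fold complex tensor power of V, as the space of complex n-linear
   functions on the complex dual of V, regarded as a real vector space. *)
Record tensor (R : realType) (V : vectType R) (J : V -> V) (n : nat) :=
  Tensor { tensor_val :> ('I_n -> cdual J) -> Rcomplex R;
           tensorP : cmultilinear_pred tensor_val }.

HB.instance Definition _ (R : realType) (V : vectType R) (J : V -> V) n :=
  [isSub for @tensor_val R V J n].
HB.instance Definition _ (R : realType) (V : vectType R) (J : V -> V) n :=
  [Choice of tensor J n by <:].

Lemma cmultilinear_submod (R : realType) (V : vectType R) (J : V -> V) n :
  submod_closed (@cmultilinear_pred R V J n).
Proof.
split=> [|r f g /asboolP fM /asboolP gM]; apply/asboolP => al i c a b.
  by rewrite mulr0 addr0.
rewrite !fctE fM gM.
have scE (z : Rcomplex R) : r *: z = (r%:C * z : R[i]).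
  by case: z => x y; apply/eqP; rewrite eq_complex /= !mul0r subr0 addr0 !eqxx.
by rewrite !scE !mulrDr addrACA; congr (_ + _ + _); rewrite mulrCA.
Qed.

HB.instance Definition _ (R : realType) (V : vectType R) (J : V -> V) n :=
  GRing.isSubmodClosed.Build R (('I_n -> cdual J) -> Rcomplex R)
    (@cmultilinear_pred R V J n) (@cmultilinear_submod R V J n).
HB.instance Definition _ (R : realType) (V : vectType R) (J : V -> V) n :=
  [SubChoice_isSubLmodule of tensor J n by <:].

Lemma tprod_subproof (R : realType) (V : vectType R) (J : V -> V) n
    (vs : 'I_n -> V) :
  @cmultilinear_pred R V J n (fun al => \prod_(i < n) (al i (vs i)) : R[i]).
Proof.
apply/asboolP => al i c a b.
have lin v : (c *: a + b) v = c * a v + b v by [].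
have prodE d : \prod_(j < n) upd al i d j (vs j) =
               d (vs i) * \prod_(j < n | j != i) al j (vs j).
  rewrite (bigD1 i) //= {1}/upd eqxx; congr (_ * _).
  by apply: eq_bigr => j /negPf ji; rewrite /upd ji.
by rewrite !prodE lin mulrDl; congr (_ + _); rewrite mulrA.
Qed.

Definition tprod (R : realType) (V : vectType R) (J : V -> V) n
  (vs : 'I_n -> V) : tensor J n := Tensor (tprod_subproof J vs).

(* The norm of a tensor power of a complex line: |ab| = |a||b|, where every
   element is decomposable. *)
Definition tensor_norm (R : realType) (V : vectType R) (J : V -> V)
    (ip : V -> V -> R) n (w : tensor J n) : R :=
  xget 0 [set r | exists2 vs : 'I_n -> V,
                    w = tprod J vs & r = \prod_(i < n) norm ip (vs i)].

Definition tsquare (R : realType) (V : vectType R) (J : V -> V) (z : V)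
  : tensor J 2 := tprod J (fun=> z).

(* The conjugate of V is V itself with the conjugate complex structure; the
   product of v in V and u in the conjugate of V is their Hermitian product,
   complex linear in v. *)
Definition herm (R : realType) (V : vectType R) (J : V -> V)
  (ip : V -> V -> R) (v u : V) : R[i] := ip v u +i* ip v (J u).

Definition tinv (R : realType) (V : vectType R) (J : V -> V)
  (ip : V -> V -> R) (v : V) : V := xget 0 [set u | herm J ip v u = 1].

(* v |-> herm v u, an element of the complex dual of V ([insubd] only
   discharges its complex linearity). *)
Definition herm_dual (R : realType) (V : vectType R) (J : V -> V)
  (ip : V -> V -> R) (u : V) : cdual J :=
  insubd (0 : cdual J) (fun v => herm J ip v u).

Definition extend (T : Type) (n : nat) (a : 'I_n -> T) (b : T) (j : 'I_n.+1)
  : T := if unlift ord_max j is Some i then a i else b.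

Lemma contract_subproof (R : realType) (V : vectType R) (J : V -> V) n
    (w : tensor J n.+1) (b : cdual J) :
  @cmultilinear_pred R V J n (fun al => w (extend al b)).
Proof.
apply/asboolP => al i c f g; have /asboolP wM := tensorP w.
have eU h : extend (upd al i h) b = upd (extend al b) (lift ord_max i) h.
  apply/funext => j; rewrite /extend /upd.
  case: unliftP => [k ->|->]; first by rewrite (inj_eq lift_inj).
  by rewrite (negPf (neq_lift _ _)).
by rewrite !eU wM.
Qed.

(* The product w u of w in the (n+1)-st power with u in the conjugate of V: the
   last factor of w is multiplied with u. *)
Definition mul_conj (R : realType) (V : vectType R) (J : V -> V)
  (ip : V -> V -> R) n (w : tensor J n.+1) (u : V) : tensor J n :=
  Tensor (contract_subproof w (herm_dual J ip u)).

Definition tdiv (R : realType) (V : vectType R) (J : V -> V)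
  (ip : V -> V -> R) n (w : tensor J n.+1) (v : V) : tensor J n :=
  mul_conj ip w (tinv J ip v).

(* A local trivialization; the maps over points outside [tdom] are
   irrelevant. *)
Record ltriv (R : realType) (X : Type) (fib : X -> vectType R) (r : nat) :=
  LTriv { tdom : set X; tmap : forall x, 'Hom(fib x, 'rV[R]_r) }.

Definition triv_compat (R : realType) (X : topologicalType)
    (S : riemannian_surface R X) (fib : X -> vectType R) (r : nat)
    (t t' : ltriv fib r) :=
  forall i j : 'I_r, smooth_fun S (tdom t `&` tdom t')
    (fun x => tmap t' x ((tmap t x)^-1%VF (delta_mx 0 i)) 0 j).

Definition is_ltriv (R : realType) (X : topologicalType)
    (fib : X -> vectType R) (r : nat) (t : ltriv fib r) :=
  open (tdom t) /\ forall x, tdom t x -> bijective (tmap t x).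

Record vbundle (R : realType) (X : topologicalType)
    (S : riemannian_surface R X) (r : nat) := VBundle {
  fib :> X -> vectType R;
  trivs : set (ltriv fib r);
  trivs_triv : forall t, trivs t -> is_ltriv t;
  trivs_cover : forall x, exists2 t, trivs t & tdom t x;
  trivs_compat : forall t t', trivs t -> trivs t' -> triv_compat S t t' }.

Definition smooth_section (R : realType) (X : topologicalType)
    (S : riemannian_surface R X) (r : nat) (E : vbundle S r) (U : set X)
    (s : forall x, E x) :=
  forall t j, trivs t ->
    smooth_fun S (U `&` tdom t) (fun x => tmap t x (s x) 0 j).

(* Rank 2 bundles with a fibre metric and an orientation: near each point
   there is a smooth trivialization taking the oriented bases to the positively
   oriented ones. *)
Record so2_bundle (R : realType) (X : topologicalType)
    (S : riemannian_surface R X) := SO2Bundle {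
  so2_vb :> vbundle S 2;
  so2_ip : forall x, so2_vb x -> so2_vb x -> R;
  so2_pos : forall x, so2_vb x -> so2_vb x -> Prop;
  so2_ipP : forall x, inner_product (@so2_ip x);
  so2_ip_smooth : forall (U : set X) (s s' : forall x, so2_vb x), open U ->
    smooth_section U s -> smooth_section U s' ->
    smooth_fun S U (fun x => so2_ip (s x) (s' x));
  so2_oriented : forall x0, exists t : ltriv so2_vb 2,
    [/\ is_ltriv t,
        forall t', trivs t' -> triv_compat S t t' /\ triv_compat S t' t,
        tdom t x0
      & forall x (u v : so2_vb x), tdom t x ->
          so2_pos u v <->
          0 < \det (col_mx (tmap t x u) (tmap t x v) : 'M[R]_(1 + 1))] }.

Definition so2_J (R : realType) (X : topologicalType)
  (S : riemannian_surface R X) (F : so2_bundle S) (x : X) : F x -> F x :=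
  rot90 (@so2_ip R X S F x) (@so2_pos R X S F x).

(* A smooth vector bundle, described by its fibres and its smooth local sections,
   which determine the local trivializations up to equivalence. The sections of
   dual, tensor and homomorphism bundles are those with smooth values on smooth
   local sections of their arguments.
   [smooth_on E U s] is only used for U open, and does not depend on the values
   of s outside U. *)
Record sections (R : realType) (X : topologicalType) := Sections {
  total :> X -> lmodType R;
  smooth_on : set X -> (forall x, total x) -> Prop }.

Definition vbundle_sections (R : realType) (X : topologicalType)
    (S : riemannian_surface R X) (r : nat) (E : vbundle S r) : sections R X :=
  @Sections R X (fun x => E x : lmodType R) (@smooth_section R X S r E).

Definition sum_bundle (R : realType) (X : topologicalType)
    (E E' : sections R X) : sections R X :=
  @Sections R X (fun x => (E x * E' x)%type : lmodType R)
    (fun U s => smooth_on U (fun x => (s x).1) /\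
                smooth_on U (fun x => (s x).2)).

Definition dual_smooth (R : realType) (X : topologicalType)
    (S : riemannian_surface R X) (F : so2_bundle S) (U : set X)
    (xi : forall x, 'Hom(F x, R^o)) :=
  forall (W : set X) (s : forall x, F x), open W -> W `<=` U ->
    smooth_section W s -> smooth_fun S W (fun x => xi x (s x)).

Definition cdual_smooth (R : realType) (X : topologicalType)
    (S : riemannian_surface R X) (F : so2_bundle S) (U : set X)
    (al : forall x, cdual (@so2_J R X S F x)) :=
  forall (W : set X) (s : forall x, F x), open W -> W `<=` U ->
    smooth_section W s -> smooth_cfun S W (fun x => al x (s x)).

Definition tensor_bundle (R : realType) (X : topologicalType)
    (S : riemannian_surface R X) (F : so2_bundle S) (n : nat) : sections R X :=
  @Sections R X (fun x => tensor (@so2_J R X S F x) n : lmodType R)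
    (fun U w => forall (W : set X)
       (al : 'I_n -> forall x, cdual (@so2_J R X S F x)),
       open W -> W `<=` U -> (forall i, cdual_smooth W (al i)) ->
       smooth_cfun S W (fun x => w x (fun i => al i x))).

Definition S20_smooth (R : realType) (X : topologicalType)
    (S : riemannian_surface R X) (F : so2_bundle S) (U : set X)
    (A : forall x, subvs_of (S20 (@so2_ip R X S F x))) :=
  forall (W : set X) (s : forall x, F x), open W -> W `<=` U ->
    smooth_section W s -> smooth_section W (fun x => vsval (A x) (s x)).

Definition hom_dual_S20_bundle (R : realType) (X : topologicalType)
    (S : riemannian_surface R X) (F : so2_bundle S) : sections R X :=
  @Sections R X
    (fun x => 'Hom('Hom(F x, R^o), subvs_of (S20 (@so2_ip R X S F x)))
              : lmodType R)
    (fun U sigma => forall (W : set X) (xi : forall x, 'Hom(F x, R^o)),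
       open W -> W `<=` U -> dual_smooth W xi ->
       S20_smooth W (fun x => sigma x (xi x))).

(* Both Phi and its fibrewise inverse preserve smoothness. *)
Definition bundle_iso (R : realType) (X : topologicalType)
    (E E' : sections R X) (Phi : forall x, {linear E x -> E' x}) :=
  (forall x, bijective (Phi x)) /\
  (forall (U : set X) (s : forall x, E x), open U ->
     smooth_on U s <-> smooth_on U (fun x => Phi x (s x))).

(* Main.v *)
(* Fix a unit vector e of F_x and write v, w, z for the complex coordinates of
   v in F_x, w in F_x^3 and z in F_x. The symmetric traceless endomorphisms of
   F_x are the maps s |-> c conj(s), with g(c, d) = Re (c conj(d)), and
     Phi(v + w)(z^flat) = (v z - w conj(z)) / sqrt 2,
   an element of F_x^2, does not depend on e. In these coordinates
     G z = (|v|^2 + |w|^2) / 2 z - w conj(v) conj(z),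
   so z is an eigenvector for (|v| - s |w|)^2 / 2, with s = 1 or -1, iff
   |w conj(v)| z = s w conj(v) conj(z), that is, iff z is a real multiple of a
   square root of s w / v. Smoothness is checked in a local unit frame, which
   Gram-Schmidt produces from an oriented trivialization. *)

Require Import Defs.
From HB Require Import structures.
From mathcomp Require Import all_boot all_order all_algebra.
From mathcomp.real_closed Require Import complex.
From mathcomp Require Import all_classical all_reals all_analysis.
From mathcomp Require Import ring lra.

Set Implicit Arguments.
Unset Strict Implicit.
Unset Printing Implicit Defensive.

Import Order.TTheory GRing.Theory Num.Theory.
Import numFieldNormedType.Exports.

Local Open Scope classical_set_scope.
Local Open Scope ring_scope.
Local Open Scope complex_scope.

(* [cscale] alone would be the scaling of charges. *)
Local Notation cscale := Defs.cscale.
Local Notation im := (0 +i* 1).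
Local Notation normc := ComplexField.Normc.normc.

(** * Smooth functions *)

(** The form of Phi is dictated by weights: a real linear map from F to F^2 is the sum of a complex
    linear one, the product with an element of F, and an antilinear one, the pairing of conj(z) with
    an element of F^3. The factor 1 / sqrt 2 yields the 1/2 of the eigenvalues, and the minus sign
    assigns the smaller eigenvalue to w / v.

    The obstacle is that the objects are given abstractly: J by a choice at each point, the trace by
    an arbitrary basis, tensors as multilinear functions. Each is therefore turned into a complex
    coordinate relative to a unit vector, after which the fibrewise statements are identities in
    [R[i]]. A nontrivial F has no global unit section, so the unit vectors that define Phi at
    different points are unrelated; smoothness becomes visible only after a smooth local frame is
    substituted for them, in both directions. *)

Section SmoothCalculus.
Context (R : realType).
Implicit Types (U V : set 'rV[R]_2) (f g : 'rV[R]_2 -> R).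

Lemma Ck_sub k U V f : V `<=` U -> Ck k U f -> Ck k V f.
Proof.
move=> VU; elim: k f => [|k IH] f [fc fD]; first by split=> // p /VU/fc.
split=> [p /VU/fc//|i].
by have [fi fiD] := fD i; split=> [p /VU/fi//|]; exact: IH.
Qed.

Lemma CkS k U f : Ck k.+1 U f -> Ck k U f.
Proof.
elim: k f => [|k IH] f [fc fD]; split=> // i.
by have [fi fiD] := fD i; split=> //; exact: IH.
Qed.

(** All conditions of [Ck] are imposed at points of the ambient plane, so [V] only has to contain
    [p] and need not be open. *)
Lemma Ck_local k U f :
  (forall p, U p -> exists2 V, V p & Ck k V f) -> Ck k U f.
Proof.
elim: k f => [|k IH] f UV.
  by split=> // p Up; have [V Vp [fc _]] := UV p Up; exact: fc.
split=> [p Up|i].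
- by have [V Vp [fc _]] := UV p Up; exact: fc.
- split=> [p Up|].
    by have [V Vp [_ /(_ i)[fd _]]] := UV p Up; exact: fd.
  apply: IH => p Up; have [V Vp [_ /(_ i)[_ fd]]] := UV p Up.
  by exists V.
Qed.

(** On an open set, agreement on [U] is agreement near each of its points, so derivatives agree too.
    The calculus rules below use this to replace a derivative by a formula that holds on [U]
    only. *)
Lemma Ck_eq k U f g : open U -> {in U, f =1 g} -> Ck k U f -> Ck k U g.
Proof.
move=> oU; elim: k f g => [|k IH] f g fg [fc fD].
all: have fgp p (Up : U p) : {near p, f =1 g} by
  apply: filterS (open_nbhs_nbhs (conj oU Up)) => q Uq; apply: fg; rewrite inE.
all: have gc p (Up : U p) : {for p, continuous g} by
  rewrite /prop_for /continuous_at -(nbhs_singleton (fgp p Up));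
  apply: cvg_trans (fc p Up);
  exact: near_eq_cvg (fgp p Up).
  by [].
split=> // i.
have [fi fiD] := fD i; split=> [p Up|].
  exact: near_eq_derivable (fgp p Up) (fi p Up).
apply: IH fiD => p; rewrite inE => Up.
exact: near_eq_derive (fgp p Up).
Qed.

Lemma Ck_cst k U (c : R) : Ck k U (fun=> c).
Proof.
elim: k c => [|k IH] c; first by split=> // p _; exact: cst_continuous.
split=> [p _|i]; first exact: cst_continuous.
split=> [p _|]; first exact: derivable_cst.
rewrite [X in Ck _ _ X](_ : _ = fun=> 0) //; apply/funext => p.
exact: derive_cst.
Qed.

Lemma CkD k U f g : open U -> Ck k U f -> Ck k U g -> Ck k U (fun p => f p + g p).
Proof.
move=> oU; elim: k f g => [|k IH] f g [fc fD] [gc gD].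
  by split=> // p Up; apply: continuousD; [exact: fc|exact: gc].
split=> [p Up|i]; first by apply: continuousD; [exact: fc|exact: gc].
have [[fi fiD] [gi giD]] := (fD i, gD i).
split=> [p Up|]; first by apply: derivableD; [exact: fi|exact: gi].
apply: Ck_eq (IH _ _ fiD giD) => // p; rewrite inE => Up.
by rewrite -(deriveD (fi p Up) (gi p Up)).
Qed.

(** The Leibniz formula needs the factors themselves to order [k] only, which [CkS] supplies. The
    rules for inverses and square roots follow the same pattern: their derivatives involve the
    function itself, one order lower. *)
Lemma CkM k U f g : open U -> Ck k U f -> Ck k U g -> Ck k U (fun p => f p * g p).
Proof.
move=> oU; elim: k f g => [|k IH] f g fC gC; have [fc fD] := fC; have [gc gD] := gC.
  by split=> // p Up; apply: continuousM; [exact: fc|exact: gc].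
split=> [p Up|i]; first by apply: continuousM; [exact: fc|exact: gc].
have [[fi fiD] [gi giD]] := (fD i, gD i).
split=> [p Up|]; first by apply: derivableM; [exact: fi|exact: gi].
have := CkD oU (IH _ _ (CkS fC) giD) (IH _ _ (CkS gC) fiD).
apply: Ck_eq => // p; rewrite inE => Up.
exact: esym (deriveM (fi p Up) (gi p Up)).
Qed.

Lemma CkV k U f : open U -> (forall p, U p -> f p != 0) ->
  Ck k U f -> Ck k U (fun p => (f p)^-1).
Proof.
move=> oU f0; elim: k f f0 => [|k IH] f f0 fC; have [fc fD] := fC.
  by split=> // p Up; apply: continuousV; [exact: f0|exact: fc].
split=> [p Up|i]; first by apply: continuousV; [exact: f0|exact: fc].
have [fi fiD] := fD i.
split=> [p Up|]; first by apply: derivableV; [exact: f0|exact: fi].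
have fV := IH _ f0 (CkS fC).
have := CkM oU (CkM oU (Ck_cst k U (-1)) (CkM oU fV fV)) fiD.
apply: Ck_eq => // p; rewrite inE => Up.
rewrite (deriveV (f0 p Up) (fi p Up)) /GRing.scale /= expr2 invfM.
by rewrite mulN1r.
Qed.

(** Restriction to the line [h *: v + p] turns the directional derivative into a derivative in one
    variable, to which the chain rule applies. *)
Lemma derivable_sqrt f p v : 0 < f p -> derivable f p v ->
  is_derive p v (fun q => Num.sqrt (f q)) ((2 * Num.sqrt (f p))^-1 * 'D_v f p).
Proof.
move=> fp fv.
have lineE (g : 'rV[R]_2 -> R) : 'D_v g p = 'D_1 (fun h : R => g (h *: v + p)) 0.
  rewrite /derive; set g1 := fun h => h^-1 *: _; set g2 := fun h => h^-1 *: _.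
  suff -> : g1 = g2 by []; apply/funext => h; rewrite /g1 /g2 /=.
  by rewrite addr0 scale0r add0r [_%:A]mulr1.
have s0 := is_derive1_sqrt fp.
have f1 := (derivable1P _ _ _).1 fv.
set l := fun h : R => f (h *: v + p) in f1.
have l0 : l 0 = f p by rewrite /l scale0r add0r.
have s1 : derivable (@Num.sqrt R) (l 0) 1 by rewrite l0; exact: ex_derive.
split.
  apply/derivable1P/derivable1_diffP.
  apply: (@differentiable_comp _ _ _ _ l (@Num.sqrt R)).
    exact/derivable1_diffP.
  exact/derivable1_diffP.
rewrite !lineE -derive1E (derive1_comp f1 s1) !derive1E l0.
by rewrite (@derive_val _ _ _ _ _ _ _ s0).
Qed.

Lemma Ck_sqrt k U f : open U -> (forall p, U p -> 0 < f p) ->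
  Ck k U f -> Ck k U (fun p => Num.sqrt (f p)).
Proof.
move=> oU f0; elim: k f f0 => [|k IH] f f0 fC; have [fc fD] := fC.
  split=> // p Up; apply: (@continuous_comp _ _ _ f (@Num.sqrt R)).
    exact: fc.
  exact: sqrt_continuous.
split=> [p Up|i].
  apply: (@continuous_comp _ _ _ f (@Num.sqrt R)); first exact: fc.
  exact: sqrt_continuous.
have [fi fiD] := fD i.
split=> [p Up|]; first by have [] := derivable_sqrt (f0 p Up) (fi p Up).
have sf := CkM oU (Ck_cst k U 2) (IH _ f0 (CkS fC)).
have sf0 p : U p -> 2 * Num.sqrt (f p) != 0.
  by move=> Up; rewrite mulf_neq0 ?pnatr_eq0 // gt_eqF // sqrtr_gt0 f0.
have := CkM oU (CkV oU sf0 sf) fiD.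
apply: Ck_eq => // p; rewrite inE => Up.
by have [_ ->] := derivable_sqrt (f0 p Up) (fi p Up).
Qed.

End SmoothCalculus.

(** * Smooth real and complex functions on the surface *)

Section SmoothFunctions.
Context (R : realType) (X : topologicalType) (S : riemannian_surface R X).
Implicit Types (U V W : set X) (f g : X -> R).

(** Inside the open image of the chart, the image of [U] is the preimage of [cdom c] and [U] under
    [cinv c], which is continuous there. *)
Lemma chart_image_open (c : chart R X) U :
  atlas S c -> open U -> open (cmap c @` (cdom c `&` U)).
Proof.
move=> /(atlas_chart)[oc oi cK _ ic] oU.
rewrite openE => p [x [cx Ux] <-].
have ip : (cmap c @` cdom c) (cmap c x) by exists x.
have : nbhs (cmap c x) ((cmap c @` cdom c) `&` (cinv c @^-1` (cdom c `&` U))).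
  apply: filterI; first exact: open_nbhs_nbhs.
  apply: (ic _ ip); rewrite cK //; apply: open_nbhs_nbhs; split=> //.
  exact: openI.
apply: filterS => _ [[y cy <-]] /=; rewrite cK // => -[_ Uy].
by exists y.
Qed.

Lemma smooth_fun_sub U V f : V `<=` U -> smooth_fun S U f -> smooth_fun S V f.
Proof.
move=> VU fs c ca k; apply: Ck_sub (fs c ca k).
by move=> _ [x [cx /VU Ux] <-]; exists x.
Qed.

Lemma smooth_fun_local U f :
  (forall x, U x -> exists2 V, V x & smooth_fun S (V `&` U) f) ->
  smooth_fun S U f.
Proof.
move=> UV c ca k; apply: Ck_local => _ [x [cx Ux] <-].
have [V Vx fs] := UV x Ux.
by exists (cmap c @` (cdom c `&` (V `&` U))); [exists x|exact: fs].
Qed.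

Lemma smooth_fun_eq U f g : open U -> (forall x, U x -> f x = g x) ->
  smooth_fun S U f -> smooth_fun S U g.
Proof.
move=> oU fg fs c ca k; apply: Ck_eq (fs c ca k).
  exact: chart_image_open.
move=> p; rewrite inE => -[x [cx Ux] <-] /=.
have [_ _ cK _ _] := atlas_chart ca.
by rewrite cK // fg.
Qed.

Lemma smooth_fun_cst U a : smooth_fun S U (fun=> a).
Proof. by move=> c ca k; exact: Ck_cst. Qed.

Lemma smooth_funD U f g : open U -> smooth_fun S U f -> smooth_fun S U g ->
  smooth_fun S U (fun x => f x + g x).
Proof.
move=> oU fs gs c ca k.
exact: (CkD (chart_image_open ca oU) (fs c ca k) (gs c ca k)).
Qed.

Lemma smooth_funM U f g : open U -> smooth_fun S U f -> smooth_fun S U g ->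
  smooth_fun S U (fun x => f x * g x).
Proof.
move=> oU fs gs c ca k.
exact: (CkM (chart_image_open ca oU) (fs c ca k) (gs c ca k)).
Qed.

Lemma smooth_funN U f : open U -> smooth_fun S U f ->
  smooth_fun S U (fun x => - f x).
Proof.
move=> oU fs; apply: smooth_fun_eq (smooth_funM oU (smooth_fun_cst U (-1)) fs) => //.
by move=> x _; rewrite mulN1r.
Qed.

Lemma smooth_funV U f : open U -> (forall x, U x -> f x != 0) ->
  smooth_fun S U f -> smooth_fun S U (fun x => (f x)^-1).
Proof.
move=> oU f0 fs c ca k.
apply: (CkV (chart_image_open ca oU) _ (fs c ca k)) => _ [x [cx Ux] <-] /=.
by have [_ _ cK _ _] := atlas_chart ca; rewrite cK // f0.
Qed.

Lemma smooth_fun_sqrt U f : open U -> (forall x, U x -> 0 < f x) ->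
  smooth_fun S U f -> smooth_fun S U (fun x => Num.sqrt (f x)).
Proof.
move=> oU f0 fs c ca k.
apply: (Ck_sqrt (chart_image_open ca oU) _ (fs c ca k)) => _ [x [cx Ux] <-] /=.
by have [_ _ cK _ _] := atlas_chart ca; rewrite cK // f0.
Qed.

Implicit Types F G : X -> R[i].

Lemma smooth_cfun_eq U F G : open U -> (forall x, U x -> F x = G x) ->
  smooth_cfun S U F -> smooth_cfun S U G.
Proof.
by move=> oU FG [F1 F2]; split; [apply: smooth_fun_eq F1|apply: smooth_fun_eq F2];
  move=> // x /FG ->.
Qed.

Lemma smooth_cfun_local U F :
  (forall x, U x -> exists2 V, V x & smooth_cfun S (V `&` U) F) ->
  smooth_cfun S U F.
Proof.
by move=> UV; split; apply: smooth_fun_local => x /UV[V Vx [F1 F2]]; exists V.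
Qed.

Lemma smooth_cfun_cst U c : smooth_cfun S U (fun=> c).
Proof. by split; exact: smooth_fun_cst. Qed.

Lemma smooth_cfunD U F G : open U -> smooth_cfun S U F -> smooth_cfun S U G ->
  smooth_cfun S U (fun x => F x + G x).
Proof.
move=> oU [F1 F2] [G1 G2]; split.
  apply: smooth_fun_eq (smooth_funD oU F1 G1) => // x _.
  by case: (F x) (G x) => ? ? [].
apply: smooth_fun_eq (smooth_funD oU F2 G2) => // x _.
by case: (F x) (G x) => ? ? [].
Qed.

Lemma smooth_cfunM U F G : open U -> smooth_cfun S U F -> smooth_cfun S U G ->
  smooth_cfun S U (fun x => F x * G x).
Proof.
move=> oU [F1 F2] [G1 G2]; split.
  apply: smooth_fun_eq (smooth_funD oU (smooth_funM oU F1 G1)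
    (smooth_funN oU (smooth_funM oU F2 G2))) => // x _.
  by case: (F x) (G x) => ? ? [].
apply: smooth_fun_eq (smooth_funD oU (smooth_funM oU F1 G2)
    (smooth_funM oU F2 G1)) => // x _.
by case: (F x) (G x) => ? ? [].
Qed.

Lemma smooth_cfun_conj U F : open U -> smooth_cfun S U F ->
  smooth_cfun S U (fun x => conjc (F x)).
Proof.
move=> oU [F1 F2]; split; first by apply: smooth_fun_eq F1 => // x _; case: (F x).
by apply: smooth_fun_eq (smooth_funN oU F2) => // x _; case: (F x).
Qed.

End SmoothFunctions.

(** * Complex coordinates on a fibre *)

Lemma linfunE (K : fieldType) (U V : vectType K) (f : U -> V) :
  linear f -> linfun f =1 f.
Proof.
move=> lf; pose g : {linear U -> V} :=
  HB.pack f (GRing.isLinear.Build K U V *:%R _ lf).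
exact: (lfunE g).
Qed.

Lemma scale_Rcomplex (R : realType) (r : R) (z : Rcomplex R) :
  r *: z = (r%:C * z : R[i]).
Proof. by case: z => x y; apply/eqP; rewrite eq_complex /= !mul0r subr0 addr0 !eqxx. Qed.

Section FibreCoordinates.
Context (R : realType) (V : vectType R) (ip : V -> V -> R) (J : V -> V).

(** [J] is a mere function here. The last two clauses provide its linearity: [e] and [J e] span, and
    [J] acts on their combinations as a quarter turn. *)
Definition unit_frame (e : V) :=
  [/\ ip e e = 1, ip (J e) (J e) = 1, ip e (J e) = 0,
      forall v, v = ip v e *: e + ip v (J e) *: J e
    & forall a b, J (a *: e + b *: J e) = - b *: e + a *: J e].

Definition crd (e v : V) : R[i] := herm J ip v e.

(** The coordinate of [w] with respect to the n-th power of [e], read off by evaluating [w] on n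
    copies of the dual vector of [e]. *)
Definition tcrd n (e : V) (w : tensor J n) : R[i] :=
  w (fun=> herm_dual J ip e).

#[global] Arguments crd : simpl never.
#[global] Arguments tcrd : simpl never.

Hypothesis ipP : inner_product ip.

Lemma ipZDl a u v w : ip (a *: u + v) w = a * ip u w + ip v w.
Proof. by case: ipP. Qed.

Lemma ip_sym u v : ip u v = ip v u.
Proof. by case: ipP. Qed.

Lemma ipDl u v w : ip (u + v) w = ip u w + ip v w.
Proof. by rewrite -[u]scale1r ipZDl mul1r scale1r. Qed.

Lemma ip0l w : ip 0 w = 0.
Proof. by apply: (addrI (ip 0 w)); rewrite -ipDl !addr0. Qed.

Lemma ipZl a u w : ip (a *: u) w = a * ip u w.
Proof. by rewrite -[a *: u]addr0 ipZDl ip0l addr0. Qed.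

Lemma ipDr w u v : ip w (u + v) = ip w u + ip w v.
Proof. by rewrite ip_sym ipDl ![ip _ w]ip_sym. Qed.

Lemma ipZr a w u : ip w (a *: u) = a * ip w u.
Proof. by rewrite ip_sym ipZl ip_sym. Qed.

Lemma ip_gt0 u : u != 0 -> 0 < ip u u.
Proof. by case: ipP => _ _; apply. Qed.

Lemma crd_linear e a u v : crd e (a *: u + v) = a%:C * crd e u + crd e v.
Proof.
rewrite /crd /herm !ipZDl; apply/eqP; rewrite eq_complex /=.
by apply/andP; split; apply/eqP; ring.
Qed.

Lemma crdD e u v : crd e (u + v) = crd e u + crd e v.
Proof. by rewrite -[u]scale1r crd_linear mul1r scale1r. Qed.

Lemma crd0 e : crd e 0 = 0.
Proof. by rewrite /crd /herm !ip0l. Qed.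

Lemma crdZ e a u : crd e (a *: u) = a%:C * crd e u.
Proof. by rewrite -[a *: u]addr0 crd_linear crd0 addr0. Qed.

Lemma tcrd_linear n e a (u v : tensor J n) :
  tcrd e (a *: u + v) = a%:C * tcrd e u + tcrd e v.
Proof. by rewrite -scale_Rcomplex. Qed.

Section Frame.
Context (e : V) (fe : unit_frame e).

Lemma crdK v : cscale J (crd e v) e = v.
Proof. by case: fe => _ _ _ /(_ v) {2}->. Qed.

Lemma cscaleK c : crd e (cscale J c e) = c.
Proof.
case: fe => e1 e2 e3 _ _; case: c => a b; rewrite /crd /herm /cscale /=.
rewrite !ipDl !ipZl e1 e2 e3 ip_sym e3; apply/eqP; rewrite eq_complex /=.
by apply/andP; split; apply/eqP; ring.
Qed.

Lemma crd_inj : injective (crd e).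
Proof. exact: (@can_inj _ _ _ (fun c => cscale J c e) crdK). Qed.

Lemma crd_eq0 v : (crd e v == 0) = (v == 0).
Proof. by rewrite -(inj_eq crd_inj) crd0. Qed.

Lemma crdJ v : crd e (J v) = im * crd e v.
Proof.
have -> : J v = cscale J (im * crd e v) e.
  case: fe => _ _ _ /(_ v) vE Je; rewrite {1}vE Je /cscale /crd /herm /=.
  by congr (_ *: _ + _ *: _); ring.
exact: cscaleK.
Qed.

Lemma crd_cscale c v : crd e (cscale J c v) = c * crd e v.
Proof.
rewrite /cscale crdD !crdZ crdJ mulrA -mulrDl; congr (_ * _).
by apply/eqP; rewrite eq_complex /=; apply/andP; split; apply/eqP; ring.
Qed.

Lemma ip_crd u v : ip u v = complex.Re (crd e u * conjc (crd e v)).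
Proof.
case: fe => e1 e2 e3 eE _; rewrite {1}(eE u) {1}(eE v).
rewrite !ipDl !ipDr !ipZl !ipZr e1 e2 e3 [ip (J e) e]ip_sym e3 /crd /herm /=.
by ring.
Qed.

Lemma herm_crd u v : herm J ip u v = crd e u * conjc (crd e v).
Proof.
rewrite /herm (ip_crd u v) (ip_crd u (J v)) crdJ.
case: (crd e u) (crd e v) => a b [c d]; apply/eqP; rewrite eq_complex /=.
by apply/andP; split; apply/eqP; ring.
Qed.

Lemma crd_frame : crd e e = 1.
Proof. by case: fe => e1 _ e3 _ _; rewrite /crd /herm e1 e3. Qed.

Lemma herm_dualE u v : herm_dual J ip u v = herm J ip v u.
Proof.
rewrite /herm_dual /insubd insubT //=; apply/asboolP; split=> [x y|c x].
  by rewrite !herm_crd crdD mulrDl.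
by rewrite !herm_crd crd_cscale mulrA.
Qed.

Lemma cdual_crd (f : cdual J) v : f v = crd e v * f e.
Proof.
by have /asboolP[_ fZ] := cdualP f; rewrite -{1}(crdK v) fZ.
Qed.

Lemma cdual_eq (f g : cdual J) : f e = g e -> f = g.
Proof. by move=> fg; apply/val_inj/funext => v /=; rewrite (cdual_crd f) (cdual_crd g) fg. Qed.

Lemma cdualE (f : cdual J) : f = f e *: herm_dual J ip e.
Proof.
apply: cdual_eq.
rewrite -[RHS]/(f e * herm_dual J ip e e) herm_dualE herm_crd crd_frame.
by rewrite conjc1 !mulr1.
Qed.

Lemma tensor_updZ n (w : tensor J n) al i c a :
  w (upd al i (c *: a)) = c * w (upd al i a) :> R[i].
Proof.
have /asboolP wM := tensorP w.
have w0 : w (upd al i 0) = 0 :> R[i].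
  have := wM al i 1 0 0; rewrite scale1r addr0 mul1r => w0.
  by apply: (addrI (w (upd al i 0) : R[i])); rewrite -w0 addr0.
by rewrite -[c *: a]addr0 wM w0 addr0.
Qed.

(** The power of a complex line is a line: each [al i] is [al i e] times the dual vector of [e], and
    multilinearity extracts these scalars one at a time. In [mix k] the first [k] arguments are
    already replaced. *)
Lemma tensor_crd n (w : tensor J n) al : w al = (\prod_(i < n) al i e) * tcrd e w.
Proof.
pose mix k (i : 'I_n) := if (i < k)%N then herm_dual J ip e else al i.
suff mixE k : (k <= n)%N ->
    w al = (\prod_(i < n | (i < k)%N) al i e) * w (mix k) :> R[i].
  rewrite (mixE n) //; congr (_ * _); first by apply: eq_bigl => i; rewrite ltn_ord.
  by rewrite /tcrd; congr (tensor_val w _); apply/funext => i; rewrite /mix ltn_ord.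
elim: k => [|k IH] kn.
  by rewrite big_pred0 // mul1r; congr (tensor_val w _); apply/funext => i.
rewrite IH 1?ltnW // [in RHS](bigD1 (Ordinal kn)) //= [X in _ = X * _]mulrC -mulrA.
congr (_ * _); first by apply: eq_bigl => i; rewrite -val_eqE /= ltnS ltn_neqAle andbC.
have -> : mix k = upd (mix k.+1) (Ordinal kn) (al (Ordinal kn)).
  apply/funext => i; rewrite /mix /upd -val_eqE /= ltnS.
  case: eqP => [ik|/eqP ik].
    by rewrite ik ltnn; congr al; apply: val_inj.
  by rewrite [in RHS]leq_eqVlt (negPf ik).
rewrite {1}(cdualE (al (Ordinal kn))) tensor_updZ; congr (_ * _).
congr (tensor_val w _).
by apply/funext => i; rewrite /mix /upd -val_eqE; case: eqP => //= ->; rewrite ltnSn.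
Qed.

Lemma tcrd_inj n : injective (@tcrd n e).
Proof.
by move=> w w' ww'; apply/val_inj/funext => al /=; rewrite (tensor_crd w) (tensor_crd w') ww'.
Qed.

Lemma tcrd0 n : tcrd e (0 : tensor J n) = 0.
Proof. by []. Qed.

Lemma tcrdN n (w : tensor J n) : tcrd e (- w) = - tcrd e w.
Proof. by []. Qed.

Lemma tcrd_eq0 n (w : tensor J n) : (tcrd e w == 0) = (w == 0).
Proof. by rewrite -(inj_eq (@tcrd_inj n)) tcrd0. Qed.

Lemma tcrd_tprod n (vs : 'I_n -> V) : tcrd e (tprod J vs) = \prod_(i < n) crd e (vs i).
Proof. by rewrite /tcrd /=; apply: eq_bigr => i _; rewrite herm_dualE. Qed.

(** The degree is positive because one factor has to carry the scalar [c]. *)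
Definition tensor_of n (c : R[i]) : tensor J n.+1 :=
  tprod J (fun i => if i == ord0 then cscale J c e else e).

Lemma tensor_ofK n c : tcrd e (tensor_of n c) = c.
Proof.
rewrite tcrd_tprod big_ord_recl /= cscaleK big1 ?mulr1 // => i _.
exact: crd_frame.
Qed.

Lemma norm_crd v : norm ip v = ComplexField.Normc.normc (crd e v).
Proof.
rewrite /norm ip_crd; case: (crd e v) => a b /=.
by congr Num.sqrt; ring.
Qed.

(** Every decomposition of [w] gives the same product of norms, by multiplicativity of [normc], and
    [tensor_of] shows that a decomposition exists, so the choice in [tensor_norm] does not fall back
    on its default. *)
Lemma tensor_norm_crd n (w : tensor J n.+1) :
  tensor_norm ip w = ComplexField.Normc.normc (tcrd e w).
Proof.
have normE (vs : 'I_n.+1 -> V) :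
    \prod_(i < n.+1) norm ip (vs i) = ComplexField.Normc.normc (tcrd e (tprod J vs)).
  rewrite tcrd_tprod (big_morph _ (@ComplexField.Normc.normcM R) (ComplexField.Normc.normc1 R)).
  by apply: eq_bigr => i _; exact: norm_crd.
rewrite /tensor_norm; case: xgetP => [r _ [vs -> ->]//|noR].
exfalso; have [] := noR (ComplexField.Normc.normc (tcrd e w)).
exists (fun i => if i == ord0 then cscale J (tcrd e w) e else e).
  by apply: tcrd_inj; rewrite tensor_ofK.
by rewrite normE; congr ComplexField.Normc.normc; rewrite tensor_ofK.
Qed.

Lemma tcrd_tsquare z : tcrd e (tsquare J z) = crd e z ^+ 2.
Proof. by rewrite tcrd_tprod big_ord_recl big_ord1 expr2. Qed.

(** The inverse lives in the conjugate line, realized on [V] itself; hence the conjugate in its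
    coordinate. *)
Lemma crd_tinv v : v != 0 -> crd e (tinv J ip v) = (conjc (crd e v)^-1).
Proof.
rewrite -crd_eq0 => v0; rewrite /tinv; case: xgetP => [u _ uE|noU].
  rewrite /= herm_crd in uE; apply: (can_inj (@conjcK R)); rewrite conjcK.
  by apply: (mulfI v0); rewrite uE divff.
exfalso; suff : herm J ip v (cscale J (conjc (crd e v)^-1) e) = 1 by exact: noU.
by rewrite herm_crd cscaleK conjcK divff.
Qed.

Lemma tcrd_tdiv n (w : tensor J n.+1) v : v != 0 ->
  tcrd e (tdiv ip w v) = tcrd e w / crd e v.
Proof.
move=> v0; rewrite {1}/tcrd /tdiv /= tensor_crd mulrC; congr (_ * _).
rewrite big_ord_recr /= big1 ?mul1r => [|i _].
  by rewrite /extend unlift_none herm_dualE herm_crd crd_frame mul1r crd_tinv // conjcK.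
have -> : widen_ord (leqnSn n) i = lift ord_max i.
  by apply: val_inj; rewrite /= /bump leqNgt ltn_ord.
by rewrite /extend liftK herm_dualE herm_crd crd_frame conjc1 mulr1.
Qed.

End Frame.
End FibreCoordinates.

(** * Symmetric traceless endomorphisms *)

Lemma conjc_linear (R : realType) (a : R) (z w : R[i]) :
  conjc (a%:C * z + w) = a%:C * conjc z + conjc w.
Proof.
by case: z w => x y [x' y']; apply/eqP; rewrite eq_complex /=;
  apply/andP; split; apply/eqP; ring.
Qed.

Lemma conjcM (R : realType) (z w : R[i]) : conjc (z * w) = conjc z * conjc w.
Proof. exact: rmorphM. Qed.

Lemma trace_linear (R : realType) (V : vectType R) : linear (@trace R V).
Proof. by move=> a A B; rewrite /trace passmx.mxof_linear mxtraceD mxtraceZ. Qed.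

Lemma traceC (R : realType) (V : vectType R) (A B : 'End(V)) :
  trace (A \o B)%VF = trace (B \o A)%VF.
Proof.
have bV := vbasisP {:V}.
by rewrite /trace !(passmx.mxof_comp _ _ bV) mxtrace_mulC.
Qed.

Section SymmetricTraceless.
Context (R : realType) (V : vectType R) (ip : V -> V -> R) (J : V -> V).
Hypothesis ipP : inner_product ip.
Context (e : V) (fe : unit_frame ip J e).
Implicit Types (c d : R[i]).

Local Notation crd := (crd ip J).
Let crdE := (crdD J ipP, crdZ J ipP, cscaleK ipP fe, crd_cscale ipP fe, crd_frame fe).

Lemma trace1 : trace (\1%VF : 'End(V)) = 2.
Proof.
rewrite /trace passmx.mxof1 ?mxtrace1; last exact: basis_free (vbasisP _).
suff -> : \dim {:V} = 2%N by [].
have [e1 e2 e3 eE _] := fe.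
have eE2 : <<[:: e; J e]>>%VS = fullv.
  apply/eqP; rewrite eqEsubv subvf /=; apply/subvP => v _; rewrite (eE v).
  by apply: memvD; apply: memvZ; apply: memv_span; rewrite !inE eqxx ?orbT.
rewrite -eE2; apply/eqP; rewrite -/(free [:: e; J e]).
rewrite free_cons seq1_free -(crd_eq0 ipP fe (J e)) (crdJ ipP fe).
rewrite span_seq1 (crd_frame fe) mulr1 eq_complex /= oner_eq0 andbF andbT.
apply/negP => /vlineP[a eJ]; have := e3; rewrite {1}eJ ipZl // e2 mulr1 => a0.
by have := e1; rewrite eJ a0 scale0r ip0l // => /esym/eqP; rewrite oner_eq0.
Qed.

Definition cmulE c : 'End(V) := linfun (cscale J c).

Definition symE c : 'End(V) := linfun (fun s => cscale J (c * conjc (crd e s)) e).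

Lemma cmulEE c v : cmulE c v = cscale J c v.
Proof.
apply: linfunE => a x y; apply: (crd_inj fe).
by rewrite !crdE mulrDr mulrCA.
Qed.

Lemma symEE c s : symE c s = cscale J (c * conjc (crd e s)) e.
Proof.
apply: linfunE => a x y; apply: (crd_inj fe); rewrite !crdE.
by rewrite conjc_linear mulrDr mulrCA.
Qed.

(** This and the next two lemmas form the composition table of complex linear and antilinear maps,
    from which the traces follow by cyclicity. *)
Lemma symE_comp c d : (symE c \o symE d)%VF = cmulE (c * conjc d).
Proof.
apply/lfunP => s; rewrite comp_lfunE !symEE cmulEE; apply: (crd_inj fe).
by rewrite !crdE conjcM conjcK mulrA.
Qed.

Lemma cmulE_symE c d : (cmulE c \o symE d)%VF = symE (c * d).
Proof.
apply/lfunP => s; rewrite comp_lfunE !symEE cmulEE; apply: (crd_inj fe).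
by rewrite !crdE mulrA.
Qed.

Lemma symE_cmulE c d : (symE c \o cmulE d)%VF = symE (c * conjc d).
Proof.
apply/lfunP => s; rewrite comp_lfunE !symEE cmulEE; apply: (crd_inj fe).
by rewrite !crdE conjcM mulrA.
Qed.

Lemma cmulE_linear a c d : cmulE (a%:C * c + d) = a *: cmulE c + cmulE d.
Proof.
apply/lfunP => s; rewrite add_lfunE scale_lfunE !cmulEE; apply: (crd_inj fe).
by rewrite !crdE mulrDl mulrA.
Qed.

Lemma symE_linear a c d : symE (a%:C * c + d) = a *: symE c + symE d.
Proof.
apply/lfunP => s; rewrite add_lfunE scale_lfunE !symEE; apply: (crd_inj fe).
by rewrite !crdE mulrDl mulrA.
Qed.

Lemma cmulE1 : cmulE 1 = \1%VF.
Proof.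
by apply/lfunP => s; rewrite cmulEE id_lfunE; apply: (crd_inj fe); rewrite !crdE mul1r.
Qed.

Let trZD a (A B : 'End(V)) : trace (a *: A + B) = a * trace A + trace B.
Proof. exact: trace_linear. Qed.

Let conj_i : conjc im = - im :> R[i].
Proof. by apply/eqP; rewrite eq_complex /= oppr0 !eqxx. Qed.

Let trace_opp (f : R[i] -> 'End(V)) c :
  (forall a c d, f (a%:C * c + d) = a *: f c + f d) -> trace (f (- c)) = - trace (f c).
Proof.
move=> fl; apply/eqP; rewrite -addr_eq0 -[trace (f c)]mul1r addrC -trZD -fl.
rewrite mul1r subrr; apply/eqP; have := trZD 1 (f 0) (f 0).
by rewrite -fl mulr0 addr0 => h; lra.
Qed.

(* Cyclicity of the trace, applied to a factorization through complex
   conjugation [symE 1], shows that i and -i have the same trace. *)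
Lemma trace_cmulE c : trace (cmulE c) = 2 * complex.Re c.
Proof.
have iE : trace (cmulE im) = 0.
  have : trace (cmulE im) = trace (cmulE (- im)).
    have <- : (symE im \o symE 1)%VF = cmulE im by rewrite symE_comp conjc1 mulr1.
    by rewrite traceC symE_comp mul1r conj_i.
  by rewrite trace_opp => [h|]; [lra|exact: cmulE_linear].
have -> : c = (complex.Re c)%:C * 1 + ((complex.Im c)%:C * im + 0).
  by case: c => a b; apply/eqP; rewrite eq_complex /=; apply/andP; split; apply/eqP; ring.
have c0 : cmulE 0 = 0.
  apply/lfunP => s; rewrite cmulEE lfunE /=; apply: (crd_inj fe).
  by rewrite !crdE mul0r (crd0 J ipP).
rewrite !cmulE_linear !trZD iE cmulE1 trace1 c0.
have -> : trace (0 : 'End(V)) = 0 by have := trZD 1 0 0; rewrite scaler0 addr0 => h; lra.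
by case: c => a b /=; ring.
Qed.

(** Antilinear maps anticommute with multiplication by i, so cyclicity makes the trace of
    [symE (im * c)] its own opposite; every coefficient has the form [im * c]. *)
Lemma trace_symE c : trace (symE c) = 0.
Proof.
have -> : c = im * (- im * c).
  by rewrite mulrA; case: c => a b; apply/eqP; rewrite eq_complex /=;
    apply/andP; split; apply/eqP; ring.
move: (- im * c) => {}c.
have : trace (symE (im * c)) = trace (symE (- (im * c))).
  by rewrite -cmulE_symE traceC symE_cmulE conj_i mulrN mulrC.
by rewrite trace_opp => [h|]; [lra|exact: symE_linear].
Qed.

Lemma mem_symE c : symE c \in S20 ip.
Proof.
apply/(mem_S20 ipP); split=> [|u v]; first exact: trace_symE.
rewrite !(ip_crd ipP fe) !symEE !crdE.
by case: (crd e u) (crd e v) c => a b [a' b'] [a'' b'']; rewrite /=; ring.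
Qed.

(** A symmetric matrix with rows a, b and b, d is (a + d) / 2 times the identity plus the antilinear
    map with coefficient (a - d) / 2 + i b. Tracelessness removes the first term. *)
Lemma S20_symE A : A \in S20 ip -> A = symE (crd e (A e)).
Proof.
move=> /(mem_S20 ipP)[trA symA].
have [e1 e2 e3 eE _] := fe.
pose a := ip (A e) e; pose b := ip (A e) (J e); pose d := ip (A (J e)) (J e).
have Ae : crd e (A e) = a +i* b by [].
have AJ : crd e (A (J e)) = b +i* d.
  by rewrite /Defs.herm /b symA (ip_sym ipP).
have AE : A = ((a + d) / 2) *: \1%VF + symE (((a - d) / 2) +i* b).
  apply/lfunP => s; rewrite add_lfunE scale_lfunE id_lfunE symEE.
  apply: (crd_inj fe); rewrite !crdE {1}(eE s) linearD !linearZ /= !crdE Ae AJ.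
  rewrite /crd /herm; apply/eqP; rewrite eq_complex /=.
  by apply/andP; split; apply/eqP; field.
have ad : a + d = 0.
  by have := trA; rewrite AE trZD trace1 trace_symE; lra.
by rewrite {1}AE Ae ad mul0r scale0r add0r; congr (symE (_ +i* _)); lra.
Qed.

Definition symS c : subvs_of (S20 ip) := vsproj (S20 ip) (symE c).

Lemma symSK c : vsval (symS c) = symE c.
Proof. exact: vsprojK (mem_symE c). Qed.

Lemma symS_linear a c d : symS (a%:C * c + d) = a *: symS c + symS d.
Proof. by rewrite /symS symE_linear linearP. Qed.

Lemma S20_ip_symS c d : S20_ip (symS c) (symS d) = complex.Re (c * conjc d).
Proof. by rewrite /S20_ip !symSK symE_comp trace_cmulE mulrA mulVf ?mul1r. Qed.

Lemma symS_surj (A : subvs_of (S20 ip)) : A = symS (crd e (vsval A e)).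
Proof. by apply: val_inj; rewrite /= symSK; exact: S20_symE (subvsP A). Qed.

Lemma crd_symS c : crd e (vsval (symS c) e) = c.
Proof. by rewrite symSK symEE !crdE conjc1 mulr1. Qed.

End SymmetricTraceless.

(** * The eigenvalue problem *)

Section ComplexEigen.
Context (R : realType).
Implicit Types (p q z nu om : R[i]) (a r s : R).

Lemma normc_sqr z : (normc z ^+ 2)%:C = z * conjc z.
Proof.
case: z => a b; rewrite /= sqr_sqrtr ?addr_ge0 ?sqr_ge0 //.
by apply/eqP; rewrite eq_complex /=; apply/andP; split; apply/eqP; ring.
Qed.

Lemma normc_real r : normc r%:C = `|r|.
Proof. by rewrite /= expr0n addr0 sqrtr_sqr. Qed.

Lemma real_complex_neq0 r : r != 0 -> r%:C != 0 :> R[i].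
Proof. by rewrite eq_complex /= eqxx andbT. Qed.

Lemma normc_conj z : normc (conjc z) = normc z.
Proof. by case: z => a b /=; rewrite sqrrN. Qed.

Lemma normc_ge0 z : 0 <= normc z.
Proof. by case: z => a b; exact: sqrtr_ge0. Qed.

Lemma normc_eq0 z : (normc z == 0) = (z == 0).
Proof.
apply/eqP/eqP => [/ComplexField.Normc.eq0_normc //|->].
exact: ComplexField.Normc.normc0.
Qed.

Lemma conjc_eq_real z : conjc z = z -> z = (complex.Re z)%:C.
Proof.
case: z => a b /eqP; rewrite eq_complex /= eqxx /= => /eqP b0.
by apply/eqP; rewrite eq_complex /= eqxx /=; apply/eqP; lra.
Qed.

(** The map sending z to q conj(z) / |q| is the reflection in the real line through the square roots
    of q. With q = t^2 one has |q| = t conj(t), and for z = r t the equation reduces to r =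
    conj(r). *)
Lemma normc_eigenP q z : q != 0 ->
  (normc q)%:C * z = q * conjc z <->
  exists r, exists2 t, t ^+ 2 = q & z = r%:C * t.
Proof.
have sqE t : t ^+ 2 = q -> (normc q)%:C = t * conjc t.
  by move=> <-; rewrite expr2 ComplexField.Normc.normcM -expr2 normc_sqr.
move=> q0; split=> [|[r [t tq ->]]]; last first.
  by rewrite (sqE t tq) conjcM conjc_real -tq; ring.
pose t := sqrtc q; have tq : t ^+ 2 = q by exact: sqr_sqrtc.
have t0 : t != 0 by rewrite sqrtc_eq0.
have ct0 : conjc t != 0 by rewrite conjc_eq0.
rewrite (sqE t tq) -tq -[z](divfK t0); move: (z / t) => r.
rewrite conjcM => rE; exists (complex.Re r), t => //; congr (_ * _).
apply: conjc_eq_real; have tt0 : t ^+ 2 * conjc t != 0 by rewrite mulf_neq0 ?expf_neq0.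
apply: (mulfI tt0); rewrite -mulrA [conjc t * _]mulrC -rE; ring.
Qed.

Definition geig nu om z : R[i] :=
  ((normc nu ^+ 2 + normc om ^+ 2) / 2)%:C * z - om * conjc nu * conjc z.

(** Since s^2 = 1, the candidate eigenvalue is (|nu|^2 + |om|^2) / 2 - s |nu| |om|, so the common
    real multiple of z cancels and the reflection equation of [normc_eigenP] remains. The sign [s]
    treats both eigenvalues at once. *)
Lemma geig_sign nu om z s : s ^+ 2 = 1 ->
  geig nu om z = (2^-1 * (normc nu - s * normc om) ^+ 2)%:C * z <->
  (normc (s%:C * (om * conjc nu)))%:C * z = s%:C * (om * conjc nu) * conjc z.
Proof.
move=> s2; have s1 : `|s| = 1 by rewrite -sqrtr_sqr s2 sqrtr1.
rewrite !ComplexField.Normc.normcM normc_real s1 mul1r normc_conj /geig.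
set p := om * conjc nu; set P := normc nu; set W := normc om.
have -> : 2^-1 * (P - s * W) ^+ 2 = (P ^+ 2 + W ^+ 2) / 2 - s * (W * P).
  have -> : (P - s * W) ^+ 2 = P ^+ 2 + s ^+ 2 * W ^+ 2 - 2 * s * (W * P) by ring.
  by rewrite s2; field.
have sC : s%:C * s%:C = 1 :> R[i] by rewrite -rmorphM -expr2 s2.
have sWP : (s * (W * P))%:C = s%:C * (W * P)%:C by exact: rmorphM.
rewrite rmorphB /= mulrBl sWP.
set A := _ * z; split=> [/addrI /oppr_inj E|E].
  by rewrite -[in RHS]mulrA E !mulrA sC mul1r.
by congr (_ - _); rewrite -[in RHS]mulrA E !mulrA sC mul1r.
Qed.

(** For an eigenvector z, isolating the antilinear term and taking absolute values gives |(|nu|^2 +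
    |om|^2) / 2 - a| = |om| |nu|, which leaves two values of [a]. Conversely, a square root of s om
    conj(nu) is an eigenvector. *)
Lemma geig_eigenvalue nu om a :
  (exists2 z, z != 0 & geig nu om z = a%:C * z) <->
  a = 2^-1 * (normc nu - normc om) ^+ 2 \/ a = 2^-1 * (normc nu + normc om) ^+ 2.
Proof.
have ex s : s ^+ 2 = 1 -> exists2 z, z != 0 &
    geig nu om z = (2^-1 * (normc nu - s * normc om) ^+ 2)%:C * z.
  move=> s2; set p := s%:C * (om * conjc nu).
  have [p0|p0] := eqVneq p 0.
    (* If [nu] or [om] vanishes, the operator is a real scalar and any nonzero vector will do. *)
    exists 1; first exact: oner_neq0.
    by apply/(geig_sign _ _ _ s2); rewrite -/p p0 ComplexField.Normc.normc0 !mul0r.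
  exists (sqrtc p); first by rewrite sqrtc_eq0.
  apply/(geig_sign _ _ _ s2); apply/(normc_eigenP _ p0); exists 1, (sqrtc p).
    exact: sqr_sqrtc.
  by rewrite mul1r.
split=> [[z z0]|].
  rewrite /geig => E.
  have {}E : ((normc nu ^+ 2 + normc om ^+ 2) / 2 - a)%:C * z = om * conjc nu * conjc z.
    by rewrite rmorphB mulrBl -E; ring.
  have /(congr1 (@ComplexField.Normc.normc R)) := E.
  rewrite !ComplexField.Normc.normcM normc_real !normc_conj.
  move/mulIf; rewrite normc_eq0 => /(_ z0).
  move: (normc_ge0 nu) (normc_ge0 om).
  set P := normc nu; set W := normc om => P0 W0 /eqP.
  rewrite eqr_norml => /andP[/orP[]/eqP E' _]; [left|right].
    have -> : a = (P ^+ 2 + W ^+ 2) / 2 - W * P by rewrite -E'; lra.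
    by field.
  have -> : a = (P ^+ 2 + W ^+ 2) / 2 + W * P.
    by rewrite -[W * P]opprK -E'; lra.
  by field.
case=> ->.
  by have := ex 1 (expr1n _ _); rewrite mul1r.
have N1 : (-1) ^+ 2 = 1 :> R by rewrite sqrrN expr1n.
by have := ex (-1) N1; rewrite mulN1r opprK.
Qed.

(** The numbers s om conj(nu) and s om / nu differ by the positive factor |nu|^2, so they define the
    same reflection. *)
Lemma geig_eigenspace nu om z s : s ^+ 2 = 1 -> nu != 0 -> om != 0 ->
  geig nu om z = (2^-1 * (normc nu - s * normc om) ^+ 2)%:C * z <->
  exists r, exists2 t, t ^+ 2 = s%:C * (om / nu) & z = r%:C * t.
Proof.
move=> s2 nu0 om0; rewrite (geig_sign _ _ _ s2).
have s0 : s != 0.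
  by apply/eqP => s0; move: s2; rewrite s0 expr0n /= => /esym/eqP; rewrite oner_eq0.
have q0 : s%:C * (om / nu) != 0.
  rewrite !mulf_neq0 ?invr_eq0 //.
  exact: real_complex_neq0.
rewrite -(normc_eigenP _ q0); set q := s%:C * (om / nu).
have nn0 : normc nu ^+ 2 != 0 by rewrite expf_neq0 // normc_eq0.
have -> : s%:C * (om * conjc nu) = (normc nu ^+ 2)%:C * q.
  by rewrite normc_sqr /q; field.
have nC0 : (normc nu ^+ 2)%:C != 0 :> R[i].
  exact: real_complex_neq0.
rewrite ComplexField.Normc.normcM normc_real ger0_norm ?sqr_ge0 // rmorphM /= -!mulrA.
by split=> [/(mulfI nC0)|->].
Qed.

End ComplexEigen.

Lemma frame_norm (R : realType) (V : vectType R) (ip : V -> V -> R) (J : V -> V)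
    (e e' : V) : inner_product ip -> unit_frame ip J e -> unit_frame ip J e' ->
  crd ip J e e' * conjc (crd ip J e e') = 1.
Proof. by move=> ipP fe fe'; rewrite -(herm_crd ipP fe) -/(crd ip J e' e') crd_frame. Qed.

(** * The homomorphism attached to a pair of coordinates *)

Section Sigma.
Context (R : realType) (V : vectType R) (ip : V -> V -> R) (J : V -> V).
Hypothesis ipP : inner_product ip.
Implicit Types (e : V) (nu om : R[i]) (xi : 'Hom(V, R^o)).

Local Notation crd := (crd ip J).

Lemma flat_linear : linear (flat ip).
Proof.
by move=> a u v; apply/lfunP => w; rewrite add_lfunE scale_lfunE !(flatE ipP) ipZDl.
Qed.

Definition sig_coef e nu om xi : R[i] :=
  (Num.sqrt 2)^-1%:C *
  (crd e (sharp ip xi) * nu - conjc (crd e (sharp ip xi)) * om).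

Definition sigE e nu om : 'Hom('Hom(V, R^o), subvs_of (S20 ip)) :=
  linfun (fun xi => symS ip J e (sig_coef e nu om xi)).

Lemma sig_coef_flat e nu om z : sig_coef e nu om (flat ip z) =
  (Num.sqrt 2)^-1%:C * (crd e z * nu - conjc (crd e z) * om).
Proof. by rewrite /sig_coef (sharpK ipP). Qed.

Section Frame.
Context (e : V) (fe : unit_frame ip J e).

Lemma sigEE nu om xi : sigE e nu om xi = symS ip J e (sig_coef e nu om xi).
Proof.
apply: linfunE => a x y; rewrite -(symS_linear ipP fe); congr symS.
rewrite /sig_coef linearP (crd_linear J ipP) conjc_linear; ring.
Qed.

Lemma sigE_linear a nu om nu' om' :
  sigE e (a%:C * nu + nu') (a%:C * om + om') = a *: sigE e nu om + sigE e nu' om'.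
Proof.
apply/lfunP => xi; rewrite add_lfunE scale_lfunE !sigEE -(symS_linear ipP fe).
by congr symS; rewrite /sig_coef; ring.
Qed.

Lemma sigE_apply nu om xi s :
  vsval (sigE e nu om xi) s = cscale J (sig_coef e nu om xi * conjc (crd e s)) e.
Proof. by rewrite sigEE (symSK ipP fe) (symEE ipP fe). Qed.

(** On the duals of [e] and [J e] the coefficient of sigma is (nu - om) / sqrt 2 and i (nu + om) /
    sqrt 2. This system is solved for nu here and for om in [sig_om]; the explicit solution also
    carries smoothness from sigma back to v and w. *)
Definition sig_nu (sigma : 'Hom('Hom(V, R^o), subvs_of (S20 ip))) : R[i] :=
  (Num.sqrt 2 / 2)%:C * (crd e (vsval (sigma (flat ip e)) e)
                         - im * crd e (vsval (sigma (flat ip (J e))) e)).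

Definition sig_om (sigma : 'Hom('Hom(V, R^o), subvs_of (S20 ip))) : R[i] :=
  (Num.sqrt 2 / 2)%:C * (- crd e (vsval (sigma (flat ip e)) e)
                         - im * crd e (vsval (sigma (flat ip (J e))) e)).

Let sqrt2 : (Num.sqrt 2) ^+ 2 = 2 :> R.
Proof. exact: sqr_sqrtr. Qed.

Let sqrt2_neq0 : Num.sqrt 2 != 0 :> R.
Proof. by rewrite gt_eqF // sqrtr_gt0. Qed.

Let sqrt2V : (Num.sqrt 2 / 2) * (Num.sqrt 2)^-1 = 2^-1 :> R.
Proof. by field. Qed.

Let crdJe : crd e (J e) = im.
Proof. by rewrite (crdJ ipP fe) (crd_frame fe) mulr1. Qed.

Let crd_sig nu om z :
  crd e (vsval (sigE e nu om (flat ip z)) e) =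
  (Num.sqrt 2)^-1%:C * (crd e z * nu - conjc (crd e z) * om).
Proof. by rewrite sigEE (crd_symS ipP fe) sig_coef_flat. Qed.

Let half (c : R[i]) : (Num.sqrt 2 / 2)%:C * ((Num.sqrt 2)^-1%:C * c) = (2^-1)%:C * c.
Proof. by rewrite mulrA -rmorphM /= sqrt2V. Qed.

Let pull (a : R[i]) (b c d : R[i]) : a * (d * b - im * (d * c)) = a * (d * (b - im * c)).
Proof. by ring. Qed.

Lemma sig_nuK nu om : sig_nu (sigE e nu om) = nu.
Proof.
rewrite /sig_nu !crd_sig (crd_frame fe) crdJe pull half.
case: nu om => a b [c d]; apply/eqP; rewrite eq_complex /=.
by apply/andP; split; apply/eqP; field.
Qed.

Lemma sig_omK nu om : sig_om (sigE e nu om) = om.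
Proof.
rewrite /sig_om !crd_sig (crd_frame fe) crdJe -mulrN pull half.
case: nu om => a b [c d]; apply/eqP; rewrite eq_complex /=.
by apply/andP; split; apply/eqP; field.
Qed.

Lemma sigE_surj sigma : sigE e (sig_nu sigma) (sig_om sigma) = sigma.
Proof.
apply/lfunP => xi; rewrite -(flatK ipP xi); move: (sharp ip xi) => z.
have [_ _ _ eE _] := fe.
rewrite [RHS](symS_surj ipP fe) sigEE sig_coef_flat; congr symS.
(* Adding 0 brings both summands into the form [a *: u + v] on which [flat_linear] rewrites. *)
rewrite {3}(eE z) -[ip z (J e) *: J e]addr0 !flat_linear !linearP /=.
have -> : flat ip 0 = 0.
  by apply/lfunP => w; rewrite (flatE ipP) (ip0l ipP) lfunE.
rewrite linear0 addr0 !lfunE /= !scale_lfunE (crd_linear J ipP) (crdZ J ipP).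
rewrite /sig_nu /sig_om.
have -> : crd e z = ip z e +i* ip z (J e) by [].
move: (crd e _) (crd e _) (ip z e) (ip z (J e)) => [a b] [c d] x y.
apply/eqP; rewrite eq_complex /=.
by apply/andP; split; apply/eqP; field.
Qed.

(** By nondegeneracy it suffices to pair both sides with an arbitrary [u]; [Gop_def] then turns the
    left side into the polarization of |z nu - conj(z) om|^2 / 2. *)
Lemma Gop_sig nu om xi :
  crd e (sharp ip (Gop (sigE e nu om) xi)) = geig nu om (crd e (sharp ip xi)).
Proof.
rewrite -[RHS](cscaleK ipP fe); congr (crd e _).
apply: (ip_inj ipP) => u.
have := Gop_def ipP (sigE e nu om) xi (flat ip u).
rewrite /dual_ip (sharpK ipP) => ->; rewrite !sigEE (S20_ip_symS ipP fe).
rewrite (ip_crd ipP fe) (cscaleK ipP fe) sig_coef_flat /sig_coef /geig.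
move: (crd e u) (crd e _) nu om => [a b] [c d] [x y] [x' y'] /=.
rewrite !sqr_sqrtr ?addr_ge0 ?sqr_ge0 //.
(* To [field], [Num.sqrt 2] is an atom, so the value of its square is inserted as a factor 1. *)
have k2 : (Num.sqrt 2)^-1 ^+ 2 * 2 = 1 :> R by rewrite exprVn sqrt2 mulVf.
by rewrite -[RHS]mul1r -[X in _ = X * _]k2; field.
Qed.

Lemma Gop_leigenspace nu om a xi :
  (xi \in passmx.leigenspace (Gop (sigE e nu om)) a) <->
  geig nu om (crd e (sharp ip xi)) = a%:C * crd e (sharp ip xi).
Proof.
rewrite /passmx.leigenspace memv_ker add_lfunE opp_lfunE scale_lfunE id_lfunE subr_eq0.
rewrite -Gop_sig -(crdZ J ipP) -linearZ /=; split=> [/eqP ->//|/(crd_inj fe) E].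
by apply/eqP; rewrite -[LHS](flatK ipP) E flatK.
Qed.

Lemma Gop_leigenvalue nu om a : passmx.leigenvalue (Gop (sigE e nu om)) a <->
  a = 2^-1 * (normc nu - normc om) ^+ 2 \/ a = 2^-1 * (normc nu + normc om) ^+ 2.
Proof.
rewrite -geig_eigenvalue /passmx.leigenvalue; split=> [|[z z0 E]].
  rewrite -vpick0; set xi := vpick _ => xi0.
  have /Gop_leigenspace E : xi \in passmx.leigenspace (Gop (sigE e nu om)) a by exact: memv_pick.
  exists (crd e (sharp ip xi)) => //; rewrite (crd_eq0 ipP fe).
  apply: contra xi0 => /eqP s0; rewrite -[xi](flatK ipP) s0.
  by apply/eqP/lfunP => w; rewrite (flatE ipP) (ip0l ipP) lfunE.
apply/negP => /eqP L0.
have : flat ip (cscale J z e) \in passmx.leigenspace (Gop (sigE e nu om)) a.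
  by apply/Gop_leigenspace; rewrite (sharpK ipP) (cscaleK ipP fe).
rewrite L0 memv0 => /eqP /(congr1 (sharp ip)).
rewrite (sharpK ipP) linear0 => /(congr1 (crd e)).
by rewrite (cscaleK ipP fe) (crd0 J ipP); exact/eqP.
Qed.

(** With [T] equal to w / v for s = 1 and to - w / v for s = -1, this covers both eigenspaces. *)
Lemma Gop_eigen_multiples (v : V) (w : tensor J 3) (s : R) (T : tensor J 2) :
  s ^+ 2 = 1 -> v != 0 -> w != 0 -> tcrd ip e T = s%:C * tcrd ip e (tdiv ip w v) ->
  [set xi | xi \in passmx.leigenspace (Gop (sigE e (crd e v) (tcrd ip e w)))
              (2^-1 * (normc (crd e v) - s * normc (tcrd ip e w)) ^+ 2)]
  = real_multiples (flat ip @` [set z | tsquare J z = T]).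
Proof.
move=> s2 v0 w0 TE; have crdv0 : crd e v != 0 by rewrite (crd_eq0 ipP fe).
have crdw0 : tcrd ip e w != 0 by rewrite (tcrd_eq0 ipP fe).
rewrite (tcrd_tdiv ipP fe) // in TE.
apply/seteqP; split=> xi /=; rewrite Gop_leigenspace geig_eigenspace // -TE.
  move=> [r [t tT xiE]]; exists r; exists (flat ip (cscale J t e)).
    exists (cscale J t e) => //=; apply: (tcrd_inj ipP fe).
    by rewrite (tcrd_tsquare ipP fe) (cscaleK ipP fe).
  rewrite -[xi](flatK ipP) -[r *: _](flatK ipP); congr flat.
  rewrite linearZ /= (sharpK ipP); apply: (crd_inj fe).
  by rewrite xiE (crdZ J ipP) (cscaleK ipP fe).
move=> [r [_ [z /= zT <-] ->]]; exists r, (crd e z).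
  by rewrite -(tcrd_tsquare ipP fe) zT.
by rewrite linearZ /= (sharpK ipP) (crdZ J ipP).
Qed.

End Frame.

(** Replacing [e] by [e'], which is u times [e] with |u| = 1, multiplies coordinates in F and F^3 by
    conj(u) and conj(u)^3. Both terms of the coefficient then acquire conj(u)^2, and the factors u
    coming from conj(s) and from [e'] cancel it. *)
Lemma sigE_frame e e' v (w : tensor J 3) : unit_frame ip J e -> unit_frame ip J e' ->
  sigE e (crd e v) (tcrd ip e w) = sigE e' (crd e' v) (tcrd ip e' w).
Proof.
move=> fe fe'; have uu := frame_norm ipP fe fe'; set u := crd e e' in uu.
have crd' x : crd e' x = crd e x * conjc u by exact: (herm_crd ipP fe).
have tcrd' : tcrd ip e' w = conjc u ^+ 3 * tcrd ip e w.
  rewrite {1}/tcrd (tensor_crd ipP fe) prodr_const card_ord.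
  by rewrite (herm_dualE ipP fe) -/(crd e' e) crd' (crd_frame fe) mul1r.
apply/lfunP => xi; apply/val_inj/lfunP => s.
rewrite (sigE_apply fe) (sigE_apply fe'); apply: (crd_inj fe).
rewrite (cscaleK ipP fe) (crd_cscale ipP fe) -/u /sig_coef !crd' tcrd' !conjcM !conjcK.
set k := _%:C; set z := crd e (sharp ip xi); set v' := crd e v.
set w' := tcrd _ _ _; set s' := conjc (crd e s); set cz := conjc z.
have -> : k * (z * conjc u * (v' * conjc u) - cz * u * (conjc u ^+ 3 * w')) *
    (s' * u) * u = k * (z * v' * (u * conjc u) ^+ 2 - cz * w' * (u * conjc u) ^+ 3) * s'.
  by ring.
by rewrite uu !expr1n !mulr1.
Qed.

End Sigma.

(** * Oriented orthonormal frames *)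

Section OrientedFrames.
Context (R : realType) (V : vectType R) (ip : V -> V -> R).
Hypothesis ipP : inner_product ip.

Definition orthonormal (e e' : V) :=
  [/\ ip e e = 1, ip e' e' = 1, ip e e' = 0
    & forall v, v = ip v e *: e + ip v e' *: e'].

(** [rot90] is a choice, so the quarter turn must be shown to be the only admissible value as well
    as an admissible one. [D] stands for the determinant in an oriented trivialization. *)
Lemma rot90_orthonormal (pos : V -> V -> Prop) (D : V -> V -> R) (e e' : V) :
  orthonormal e e' -> (forall u v, pos u v <-> 0 < D u v) ->
  (forall a b c d, D (a *: e + b *: e') (c *: e + d *: e') = (a * d - b * c) * D e e') ->
  0 < D e e' ->
  forall a b, rot90 ip pos (a *: e + b *: e') = - b *: e + a *: e'.
Proof.
move=> [e1 e2 e3 eE] posD De D0 a b.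
have e3' : ip e' e = 0 by rewrite (ip_sym ipP).
have ipE x y z t : ip (x *: e + y *: e') (z *: e + t *: e') = x * z + y * t.
  by rewrite !(ipDl ipP) !(ipDr ipP) !(ipZl ipP) !(ipZr ipP) e1 e2 e3 e3'; ring.
have v0 : a *: e + b *: e' != 0 -> 0 < a ^+ 2 + b ^+ 2.
  by move=> /(ip_gt0 ipP); rewrite ipE !expr2.
rewrite /rot90; case: xgetP => [u _ [] | noU].
  move: (eE u); move: (ip u e) (ip u e') => c d ->; rewrite !ipE => uu vu pu.
  (* At the zero vector the orientation says nothing, but equality of lengths forces the chosen
     vector to vanish. *)
  have [v00|/[dup] /v0 ab /pu] := eqVneq (a *: e + b *: e') 0.
    have : a * a + b * b = 0 by rewrite -ipE v00 (ip0l ipP).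
    move=> ab0; have a0 : a = 0 by nra.
    have b0 : b = 0 by nra.
    have c0 : c = 0 by nra.
    have d0 : d = 0 by nra.
    by rewrite a0 b0 c0 d0 oppr0.
  rewrite posD De pmulr_lgt0 // => adbc.
  have E : a * d - b * c = a ^+ 2 + b ^+ 2.
    (* Lagrange's identity, with orthogonality and equal lengths; positive orientation then selects
       the sign of the root. *)
    have : (a * d - b * c) ^+ 2 = (a ^+ 2 + b ^+ 2) ^+ 2.
      have -> : (a * d - b * c) ^+ 2 =
          (a * a + b * b) * (c * c + d * d) - (a * c + b * d) ^+ 2 by ring.
      by rewrite vu uu; ring.
    move=> /eqP; rewrite eqf_sqr => /orP[/eqP //|/eqP]; lra.
  have ab0 : a ^+ 2 + b ^+ 2 != 0 by rewrite gt_eqF.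
  congr (_ *: _ + _ *: _); apply: (mulfI ab0).
    have -> : (a ^+ 2 + b ^+ 2) * c = a * (a * c + b * d) - b * (a * d - b * c) by ring.
    by rewrite vu E; ring.
  have -> : (a ^+ 2 + b ^+ 2) * d = b * (a * c + b * d) + a * (a * d - b * c) by ring.
  by rewrite vu E; ring.
exfalso; apply: (noU (- b *: e + a *: e')); split; rewrite ?ipE; [ring|ring|].
move=> /v0 ab; apply/posD; rewrite De mulr_gt0 //.
by rewrite mulrN opprK -!expr2.
Qed.

(** The positivity of both squared lengths is part of the conclusion because the smoothness of the
    normalizing factors rests on it. *)
Lemma gram_schmidt (f g : V) : f != 0 -> (forall c, g != c *: f) ->
  (forall v, exists a b, v = a *: f + b *: g) ->
  let e := (Num.sqrt (ip f f))^-1 *: f in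
  let h := g - ip g e *: e in
  0 < ip f f /\ 0 < ip h h /\ orthonormal e ((Num.sqrt (ip h h))^-1 *: h).
Proof.
move=> f0 gf fg e h; have ff := ip_gt0 ipP f0.
have h0 : h != 0.
  by rewrite subr_eq0 /e scalerA; exact: gf.
have hh := ip_gt0 ipP h0.
have sf : Num.sqrt (ip f f) != 0 by rewrite gt_eqF // sqrtr_gt0.
have sh : Num.sqrt (ip h h) != 0 by rewrite gt_eqF // sqrtr_gt0.
have unitE (u : V) : u != 0 ->
    ip ((Num.sqrt (ip u u))^-1 *: u) ((Num.sqrt (ip u u))^-1 *: u) = 1.
  move=> /(ip_gt0 ipP) uu; rewrite (ipZl ipP) (ipZr ipP) mulrA -invfM -expr2.
  rewrite sqr_sqrtr ?ltW //.
  by rewrite mulVf // gt_eqF.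
have e1 : ip e e = 1 by exact: unitE.
have e2 := unitE h h0; split=> //; split=> //.
have he : ip h e = 0.
  by rewrite /h -scaleNr (ipDl ipP g) (ipZl ipP (- ip g e)) e1 mulr1 addrN.
have fE : f = Num.sqrt (ip f f) *: e by rewrite /e scalerA mulfV // scale1r.
have gE : g = h + ip g e *: e by rewrite /h subrK.
clearbody h e; set e' := _ *: h in e2 *.
have e3 : ip e e' = 0 by rewrite (ipZr ipP) (ip_sym ipP) he mulr0.
have hE : h = Num.sqrt (ip h h) *: e' by rewrite /e' scalerA mulfV // scale1r.
clearbody e'.
split=> // v; suff [a [b vE]] : exists a b, v = a *: e + b *: e'.
  rewrite vE !(ipDl ipP) !(ipZl ipP) e1 e2 e3 (ip_sym ipP e' e) e3.
  by rewrite !mulr1 !mulr0 addr0 add0r.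
have [a [b ->]] := fg v.
exists (a * Num.sqrt (ip f f) + b * ip g e), (b * Num.sqrt (ip h h)).
rewrite {1}fE {1}gE {1}hE scalerDr !scalerA scalerDl -!addrA.
by congr (_ + _); rewrite addrC.
Qed.

End OrientedFrames.

Lemma det_mx22 (R : comPzRingType) (M : 'M[R]_2) :
  \det M = M 0 0 * M 1 1 - M 0 1 * M 1 0.
Proof.
rewrite (expand_det_row _ ord0) big_ord_recl big_ord1 /cofactor !det_mx11 !mxE.
have l0 : lift ord0 ord0 = 1 :> 'I_2 by apply: val_inj.
have l1 : lift (1 : 'I_2) ord0 = 0 by apply: val_inj.
by rewrite !l0 l1 /= expr0 mul1r expr1 mulN1r mulrN.
Qed.

Lemma det_col2 (R : comPzRingType) (u v : 'rV[R]_2) :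
  \det (col_mx u v : 'M[R]_(1 + 1)) = u 0 0 * v 0 1 - u 0 1 * v 0 0.
Proof.
have cu j : (col_mx u v : 'M[R]_(1 + 1)) ord0 j = u 0 j.
  by rewrite -(col_mxEu u v); congr (col_mx u v _ _); apply: val_inj.
have cv j : (col_mx u v : 'M[R]_(1 + 1)) 1 j = v 0 j.
  by rewrite -(col_mxEd u v); congr (col_mx u v _ _); apply: val_inj.
by rewrite (det_mx22 (col_mx u v)) !cu !cv.
Qed.

(** * Smooth local sections of a vector bundle *)

Section SmoothSections.
Context (R : realType) (X : topologicalType) (S : riemannian_surface R X).
Context (r : nat) (E : vbundle S r).
Implicit Types (U W : set X) (s : forall x, E x).

Lemma tdom_open (t : ltriv E r) : trivs t -> open (tdom t).
Proof. by move=> /trivs_triv[]. Qed.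

Lemma smooth_section_sub U W s : W `<=` U ->
  smooth_section U s -> smooth_section W s.
Proof.
move=> WU ss t j tt; apply: smooth_fun_sub (ss t j tt).
exact: setSI.
Qed.

Lemma smooth_section_eq U s s' : open U -> (forall x, U x -> s x = s' x) ->
  smooth_section U s -> smooth_section U s'.
Proof.
move=> oU ss' ss t j tt; apply: smooth_fun_eq (ss t j tt).
  by apply: openI => //; exact: tdom_open.
by move=> x [/ss' ->].
Qed.

Lemma smooth_section_local U s :
  (forall x, U x -> exists2 W, W x & smooth_section (W `&` U) s) ->
  smooth_section U s.
Proof.
move=> UW t j tt; apply: smooth_fun_local => x [Ux tx].
by have [W Wx ss] := UW x Ux; exists W => //; rewrite setIA; exact: ss.
Qed.

Lemma smooth_sectionD U s s' : open U -> smooth_section U s ->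
  smooth_section U s' -> smooth_section U (fun x => s x + s' x).
Proof.
move=> oU ss ss' t j tt; have oUt := openI oU (tdom_open tt).
apply: smooth_fun_eq (smooth_funD oUt (ss t j tt) (ss' t j tt)) => // x _.
by rewrite linearD mxE.
Qed.

Lemma smooth_sectionZ U f s : open U -> smooth_fun S U f ->
  smooth_section U s -> smooth_section U (fun x => f x *: s x).
Proof.
move=> oU fs ss t j tt; have oUt := openI oU (tdom_open tt).
have ft := smooth_fun_sub (@subIsetl _ U (tdom t)) fs.
apply: smooth_fun_eq (smooth_funM oUt ft (ss t j tt)) => // x _.
by rewrite linearZ mxE.
Qed.

End SmoothSections.

(** * The bundle isomorphism *)

Section SO2Frames.
Context (R : realType) (X : topologicalType) (S : riemannian_surface R X).
Context (F : so2_bundle S).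
Implicit Types (U W N : set X) (s : forall x, F x).

Local Notation ip x := (@so2_ip R X S F x).
Local Notation J x := (@so2_J R X S F x).
Local Notation ipP := (@so2_ipP R X S F).
Local Notation frame x := (unit_frame (ip x) (J x)).

(** Although [J] is chosen point by point, [J x (e x)] is smooth: it is the second Gram-Schmidt
    vector, because the two vectors are positively oriented. *)
Lemma local_unit_frame x0 : exists N (e : forall x, F x),
  [/\ open N, N x0, smooth_section N e, smooth_section N (fun x => J x (e x))
    & forall x, N x -> frame x (e x)].
Proof.
have [t [[oN tbij] tcompat tx0 tpos]] := so2_oriented F x0.
set N := tdom t in oN tbij tx0 tpos.
pose f (i : 'I_2) x : F x := (tmap t x)^-1%VF (delta_mx 0 i).
have tf i x : N x -> tmap t x (f i x) = delta_mx 0 i.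
  move=> Nx; have [g _ gK] := tbij x Nx.
  by rewrite /f limg_lfunVK // -(gK (delta_mx 0 i)) memv_img ?memvf.
(* The coordinates of [f i] in another trivialization are entries of the transition matrix. *)
have fs i : smooth_section N (f i).
  by move=> t' j /tcompat[/(_ i j) tt' _].
have fgen x : N x -> forall v : F x, exists a b, v = a *: f 0 x + b *: f 1 x.
  move=> Nx v; exists (tmap t x v 0 0), (tmap t x v 0 1).
  apply: (bij_inj (tbij x Nx)); rewrite linearD !linearZ /= !tf //.
  have l1 : lift ord0 ord0 = 1 :> 'I_2 by apply: val_inj.
  by rewrite [LHS]row_sum_delta big_ord_recl big_ord1 l1.
have f0 x : N x -> f 0 x != 0.
  move=> Nx; apply/eqP => f00; have := tf 0 x Nx.
  rewrite f00 linear0 => /rowP/(_ 0); rewrite !mxE eqxx /= => /esym/eqP.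
  by rewrite oner_eq0.
have f1 x : N x -> forall c, f 1 x != c *: f 0 x.
  move=> Nx c; apply/eqP => f10; have := tf 1 x Nx.
  rewrite f10 linearZ /= tf // => /rowP/(_ 1); rewrite !mxE /= mulr0.
  by move=> /esym/eqP; rewrite oner_eq0.
pose e x := (Num.sqrt (ip x (f 0 x) (f 0 x)))^-1 *: f 0 x.
pose h x := f 1 x - ip x (f 1 x) (e x) *: e x.
pose e' x := (Num.sqrt (ip x (h x) (h x)))^-1 *: h x.
have gs x Nx := gram_schmidt (ipP x) (f0 x Nx) (f1 x Nx) (fgen x Nx).
have invsqrt s : smooth_section N s -> (forall x, N x -> 0 < ip x (s x) (s x)) ->
    smooth_fun S N (fun x => (Num.sqrt (ip x (s x) (s x)))^-1).
  move=> ss s0; apply: smooth_funV => // [x Nx|].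
    by rewrite gt_eqF // sqrtr_gt0 s0.
  by apply: smooth_fun_sqrt => //; exact: so2_ip_smooth.
have es : smooth_section N e.
  apply: smooth_sectionZ => //; apply: invsqrt => // x Nx.
  by have [] := gs x Nx.
have hs : smooth_section N h.
  have := smooth_sectionD oN (fs 1) (smooth_sectionZ oN
    (smooth_funN oN (so2_ip_smooth oN (fs 1) es)) es).
  by apply: smooth_section_eq => // x _; rewrite scaleNr.
have e's : smooth_section N e'.
  apply: smooth_sectionZ => //; apply: invsqrt => // x Nx.
  by have [_ []] := gs x Nx.
have rotE x : N x -> forall a b, J x (a *: e x + b *: e' x) = - b *: e x + a *: e' x.
  move=> Nx; have [ff [hh oe]] := gs x Nx.
  pose D (u v : F x) := tmap t x u 0 0 * tmap t x v 0 1 - tmap t x u 0 1 * tmap t x v 0 0.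
  have tl a b (u v : F x) j : tmap t x (a *: u + b *: v) 0 j =
      a * tmap t x u 0 j + b * tmap t x v 0 j.
    by rewrite linearD !mxE; congr (_ + _); rewrite linearZ mxE.
  apply: (rot90_orthonormal (ipP x) (D := D) oe).
  - by move=> u v; rewrite tpos // det_col2.
  - move=> a b c d; rewrite /D !tl.
    move: (tmap t x _ 0 0) (tmap t x _ 0 1) (tmap t x _ 0 0) (tmap t x _ 0 1).
    by move=> u0 u1 v0 v1; ring.
  (* Gram-Schmidt is a triangular change of basis, and the determinant of the initial frame is 1, so
     only the normalizing factors survive. *)
  have -> : D (e x) (e' x) =
      (Num.sqrt (ip x (f 0 x) (f 0 x)))^-1 * (Num.sqrt (ip x (h x) (h x)))^-1.
    have te j : tmap t x (e x) 0 j = (Num.sqrt (ip x (f 0 x) (f 0 x)))^-1 * (j == 0)%:R.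
      by rewrite /e linearZ /= tf // !mxE eqxx.
    have -> : e' x = (Num.sqrt (ip x (h x) (h x)))^-1 *: f 1 x +
        (- ((Num.sqrt (ip x (h x) (h x)))^-1 * ip x (f 1 x) (e x))) *: e x.
      by rewrite -mulrN -scalerA -scalerDr scaleNr.
    rewrite /D !tl !te tf // !mxE !eqxx /=.
    by rewrite ?(mulr1, mulr0, mul0r, addr0, subr0).
  by rewrite mulr_gt0 // invr_gt0 sqrtr_gt0.
have Je x : N x -> J x (e x) = e' x.
  move=> Nx; have := rotE x Nx 1 0.
  by rewrite oppr0 !scale0r !scale1r addr0 add0r.
exists N, e; split=> // [|x Nx].
  by apply: smooth_section_eq e's => // x Nx; rewrite Je.
have [_ [_ [e1 e2 e3 eE]]] := gs x Nx.
by split; rewrite ?Je //; exact: rotE.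
Qed.

Lemma crd_smooth U s e : open U ->
  smooth_section U s -> smooth_section U e -> smooth_section U (fun x => J x (e x)) ->
  smooth_cfun S U (fun x => crd (ip x) (J x) (e x) (s x)).
Proof. by move=> oU ss es Jes; split; exact: so2_ip_smooth. Qed.

Lemma cscale_smooth U c e : open U ->
  smooth_cfun S U c -> smooth_section U e -> smooth_section U (fun x => J x (e x)) ->
  smooth_section U (fun x => cscale (J x) (c x) (e x)).
Proof.
by move=> oU [c1 c2] es Jes; apply: smooth_sectionD => //; exact: smooth_sectionZ.
Qed.

(** Chosen at each point without any continuity; [phi_funE] trades it for a smooth local frame. *)
Definition base_frame x : F x := xget 0 [set e | frame x e].

Lemma base_frameP x : frame x (base_frame x).
Proof.
have [N [e [_ Nx _ _ fe]]] := local_unit_frame x.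
by rewrite /base_frame; case: xgetP => [u -> //|/(_ (e x)) []]; exact: fe.
Qed.

Definition phi_fun x (p : F x * tensor (J x) 3) :
    'Hom('Hom(F x, R^o), subvs_of (S20 (ip x))) :=
  sigE (ip x) (J x) (base_frame x) (crd (ip x) (J x) (base_frame x) p.1)
    (tcrd (ip x) (base_frame x) p.2).

Lemma phi_fun_linear x : linear (@phi_fun x).
Proof.
move=> a [v w] [v' w']; rewrite /phi_fun /= (crd_linear _ (ipP x)) tcrd_linear.
exact: (sigE_linear (ipP x) (base_frameP x)).
Qed.

Lemma phi_funE x (e : F x) p : frame x e ->
  @phi_fun x p = sigE (ip x) (J x) e (crd (ip x) (J x) e p.1) (tcrd (ip x) e p.2).
Proof. move=> fe; exact: sigE_frame (ipP x) (base_frame x) e _ _ (base_frameP x) fe. Qed.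

Lemma phi_fun_bij x : bijective (@phi_fun x).
Proof.
have fe := base_frameP x; have P := ipP x.
pose psi (sigma : 'Hom('Hom(F x, R^o), subvs_of (S20 (ip x)))) : F x * tensor (J x) 3 :=
  (cscale (J x) (sig_nu (J x) (base_frame x) sigma) (base_frame x),
   tensor_of (J x) (base_frame x) 2 (sig_om (J x) (base_frame x) sigma)).
exists psi => [[v w]|sigma].
  rewrite /psi /phi_fun (sig_nuK P fe) (sig_omK P fe) /=; congr (_, _).
    exact: crdK fe _.
  by apply: (tcrd_inj P fe); rewrite (tensor_ofK P fe).
by rewrite /phi_fun /psi /= (cscaleK P fe) (tensor_ofK P fe) (sigE_surj P fe).
Qed.

Lemma sig_coef_smooth W e xi nu om : open W -> smooth_section W e ->
  smooth_section W (fun x => J x (e x)) -> @dual_smooth R X S F W xi ->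
  smooth_cfun S W nu -> smooth_cfun S W om ->
  smooth_cfun S W (fun x => sig_coef (ip x) (J x) (e x) (nu x) (om x) (xi x)).
Proof.
move=> oW es Jes xis nus oms.
(* The real and imaginary parts are the values of [xi] on [e] and [J e]. *)
have zs : smooth_cfun S W (fun x => crd (ip x) (J x) (e x) (sharp (ip x) (xi x))).
  split.
    apply: smooth_fun_eq (xis W e oW (@subset_refl _ W) es) => // x _.
    by rewrite /= -(flatE (ipP x)) (flatK (ipP x)).
  apply: smooth_fun_eq (xis W _ oW (@subset_refl _ W) Jes) => // x _.
  by rewrite /= -(flatE (ipP x)) (flatK (ipP x)).
apply: smooth_cfunM => //; first exact: smooth_cfun_cst.
have := smooth_cfunD oW (smooth_cfunM oW zs nus) (smooth_cfunM oW (smooth_cfun_cst S W (-1))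
  (smooth_cfunM oW (smooth_cfun_conj oW zs) oms)).
by apply: smooth_cfun_eq => // x _; rewrite mulN1r.
Qed.

Lemma herm_dual_smooth U e : open U -> smooth_section U e ->
  smooth_section U (fun x => J x (e x)) ->
  cdual_smooth U (fun x => herm_dual (J x) (ip x) (e x)).
Proof.
move=> oU es Jes W s oW WU ss.
have := crd_smooth oW ss (smooth_section_sub WU es) (smooth_section_sub WU Jes).
apply: smooth_cfun_eq => // x _.
(* Any frame at [x] serves here: it only certifies that the Hermitian product is complex linear in
   its first argument. *)
by rewrite (herm_dualE (ipP x) (base_frameP x)).
Qed.

Lemma flat_smooth U e : open U -> smooth_section U e ->
  dual_smooth U (fun x => flat (ip x) (e x)).
Proof.
move=> oU es W s oW WU ss.
apply: smooth_fun_eq (so2_ip_smooth oW (smooth_section_sub WU es) ss) => // x _.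
by rewrite (flatE (ipP x)).
Qed.

Lemma phi_fun_smooth U (v : forall x, F x) (w : forall x, tensor (J x) 3) :
  open U -> smooth_section U v ->
  @smooth_on _ _ (tensor_bundle F 3) U w ->
  @smooth_on _ _ (hom_dual_S20_bundle F) U (fun x => phi_fun (v x, w x)).
Proof.
move=> oU vs ws W xi oW WU xis W' s oW' W'W ss.
apply: smooth_section_local => x0 W'x0.
have [N [e [oN Nx0 es Jes fe]]] := local_unit_frame x0.
exists N => //; set M := N `&` W'; have oM : open M by exact: openI.
have MN : M `<=` N by exact: subIsetl.
have MW' : M `<=` W' by exact: subIsetr.
have MU : M `<=` U by move=> x /MW'/W'W/WU.
have MW : M `<=` W by move=> x /MW'/W'W.
have Mes := smooth_section_sub MN es; have MJes := smooth_section_sub MN Jes.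
have vsM := crd_smooth oM (smooth_section_sub MU vs) Mes MJes.
have wsM : smooth_cfun S M (fun x => tcrd (ip x) (e x) (w x)).
  apply: (ws M (fun _ x => herm_dual (J x) (ip x) (e x)) oM MU) => _.
  exact: herm_dual_smooth.
have xisM : dual_smooth M xi.
  by move=> Z z oZ ZM zs; apply: xis => // x /ZM/MW.
have cs := smooth_cfunM oM (sig_coef_smooth oM Mes MJes xisM vsM wsM)
  (smooth_cfun_conj oM (crd_smooth oM (smooth_section_sub MW' ss) Mes MJes)).
have := cscale_smooth oM cs Mes MJes.
apply: smooth_section_eq => // x /MN Nx.
by rewrite (phi_funE _ (fe x Nx)) (sigE_apply (ipP x) (fe x Nx)).
Qed.

(** In a smooth frame, [sig_nu] and [sig_om] express the coordinates of [v] and [w] through values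
    of the homomorphism on the smooth duals of [e] and [J e]. *)
Lemma phi_fun_smooth_inv U (v : forall x, F x) (w : forall x, tensor (J x) 3) :
  open U ->
  @smooth_on _ _ (hom_dual_S20_bundle F) U (fun x => phi_fun (v x, w x)) ->
  smooth_section U v /\ @smooth_on _ _ (tensor_bundle F 3) U w.
Proof.
move=> oU ps.
(* The frame is found inside an arbitrary open [W], since smoothness of [w] is tested on every open
   subset of [U]. *)
have loc x0 W : open W -> W `<=` U -> W x0 ->
    exists N e, [/\ open N, N x0, N `<=` W, forall x, N x -> frame x (e x)
      & [/\ smooth_section N e, smooth_section N (fun x => J x (e x)),
          smooth_cfun S N (fun x => crd (ip x) (J x) (e x) (v x))
        & smooth_cfun S N (fun x => tcrd (ip x) (e x) (w x))]].
  move=> oW WU Wx0.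
  have [N0 [e [oN0 Nx0 es Jes fe]]] := local_unit_frame x0.
  set N := N0 `&` W; have oN : open N by exact: openI.
  have NN0 : N `<=` N0 by exact: subIsetl.
  have NU : N `<=` U by move=> x [_ /WU].
  have Nes := smooth_section_sub NN0 es; have NJes := smooth_section_sub NN0 Jes.
  have comp z : smooth_section N z -> smooth_cfun S N (fun x =>
      crd (ip x) (J x) (e x) (vsval (phi_fun (v x, w x) (flat (ip x) (z x))) (e x))).
    move=> zs; apply: crd_smooth => //.
    apply: (ps N (fun x => flat (ip x) (z x)) oN NU (flat_smooth oN zs) N e) => //.
  have c1 := comp _ Nes; have c2 := comp _ NJes.
  have K c := smooth_cfun_cst S N c.
  exists N, e; split=> //; first exact: subIsetr.
    by move=> x /NN0/fe.
  split=> //.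
    have := smooth_cfunM oN (K (Num.sqrt 2 / 2)%:C)
      (smooth_cfunD oN c1 (smooth_cfunM oN (K (-1)) (smooth_cfunM oN (K im) c2))).
    apply: smooth_cfun_eq => // x /NN0 Nx; rewrite mulN1r.
    rewrite -[RHS](sig_nuK (ipP x) (fe x Nx) _ (tcrd (ip x) (e x) (w x))).
    by rewrite /sig_nu -(phi_funE (v x, w x) (fe x Nx)).
  have := smooth_cfunM oN (K (Num.sqrt 2 / 2)%:C)
    (smooth_cfunD oN (smooth_cfunM oN (K (-1)) c1)
      (smooth_cfunM oN (K (-1)) (smooth_cfunM oN (K im) c2))).
  apply: smooth_cfun_eq => // x /NN0 Nx; rewrite !mulN1r.
  rewrite -[RHS](sig_omK (ipP x) (fe x Nx) (crd (ip x) (J x) (e x) (v x))).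
  by rewrite /sig_om -(phi_funE (v x, w x) (fe x Nx)).
split.
  apply: smooth_section_local => x0 Ux0.
  have [N [e [oN Nx0 NU fe [es Jes vs _]]]] := loc x0 U oU (@subset_refl _ U) Ux0.
  exists N => //; rewrite setIidl //.
  apply: smooth_section_eq (cscale_smooth oN vs es Jes) => // x Nx.
  exact: crdK (fe x Nx) _.
move=> W al oW WU als; apply: smooth_cfun_local => x0 Wx0.
have [N [e [oN Nx0 NW fe [es Jes _ ws]]]] := loc x0 W oW WU Wx0.
exists N => //; rewrite setIidl //.
have als' i := als i N e oN NW es.
have := smooth_cfunM oN (smooth_cfunM oN (als' ord0)
  (smooth_cfunM oN (als' (lift ord0 ord0)) (als' (lift ord0 (lift ord0 ord0))))) ws.
apply: smooth_cfun_eq => // x Nx.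
rewrite (tensor_crd (ipP x) (fe x Nx)) !big_ord_recl big_ord0 mulr1 !mulrA.
by [].
Qed.

End SO2Frames.

(** * The isomorphism and its eigenspaces *)

Section Main.
Context (R : realType) (X : topologicalType).
Context (S : riemannian_surface R X) (F : so2_bundle S).

Definition phi (x : X) :
  {linear sum_bundle (vbundle_sections F) (tensor_bundle F 3) x
          -> hom_dual_S20_bundle F x} :=
  HB.pack (@phi_fun R X S F x)
    (GRing.isLinear.Build R _ _ _ _ (@phi_fun_linear R X S F x)).

Lemma phi_bundle_iso : bundle_iso phi.
Proof.
split=> [x|U s oU]; first exact: phi_fun_bij.
have sE : (fun x => phi_fun ((s x).1, (s x).2)) = (fun x => phi x (s x)).
  by apply: functional_extensionality_dep => x; case: (s x).
split=> [[vs ws]|ps]; first by rewrite -sE; exact: phi_fun_smooth.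
have [] := phi_fun_smooth_inv (v := fun x => (s x).1) (w := fun x => (s x).2) oU.
  by rewrite sE.
by [].
Qed.

End Main.

Theorem theorem13 (R : realType) (X : topologicalType)
    (S : riemannian_surface R X) (F : so2_bundle S)
    (X_compact : compact [set: X]) (X_connected : connected [set: X]) :
  exists Phi : forall x : X,
      {linear sum_bundle (vbundle_sections F) (tensor_bundle F 3) x
              -> hom_dual_S20_bundle F x},
    bundle_iso Phi /\
    forall (x : X) (v : F x) (w : tensor (@so2_J R X S F x) 3),
      let ip := @so2_ip R X S F x in
      let J := @so2_J R X S F x in
      let G := Gop (Phi x (v, w)) in
      let kappa1 := 2^-1 * (norm ip v - tensor_norm ip w) ^+ 2 in
      let kappa2 := 2^-1 * (norm ip v + tensor_norm ip w) ^+ 2 in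
      (forall a : R, passmx.leigenvalue G a <-> a = kappa1 \/ a = kappa2) /\
      (v != 0 -> w != 0 ->
         [set xi | xi \in passmx.leigenspace G kappa1]
           = real_multiples (flat ip @` [set z | tsquare J z = tdiv ip w v]) /\
         [set xi | xi \in passmx.leigenspace G kappa2]
           = real_multiples
               (flat ip @` [set z | tsquare J z = - tdiv ip w v])).
Proof.
exists (@phi R X S F); split=> [|x v w ip J G kappa1 kappa2].
  exact: phi_bundle_iso.
have fe := base_frameP F x; have P := @so2_ipP R X S F x.
have GE : G = Gop (sigE ip J (base_frame F x) (crd ip J (base_frame F x) v)
    (tcrd ip (base_frame F x) w)) by [].
(* The explicit factors 1 and -1 are the sign [s] of [Gop_eigen_multiples]. *)
have k1 : kappa1 = 2^-1 * (normc (crd ip J (base_frame F x) v)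
    - 1 * normc (tcrd ip (base_frame F x) w)) ^+ 2.
  by rewrite mul1r -(norm_crd P fe) -(tensor_norm_crd P fe).
have k2 : kappa2 = 2^-1 * (normc (crd ip J (base_frame F x) v)
    - -1 * normc (tcrd ip (base_frame F x) w)) ^+ 2.
  by rewrite mulN1r opprK -(norm_crd P fe) -(tensor_norm_crd P fe).
split=> [a|v0 w0].
  rewrite k1 k2 mul1r mulN1r opprK.
  by rewrite GE; apply: (Gop_leigenvalue P fe).
rewrite k1 k2 GE; split.
  apply: (Gop_eigen_multiples P fe) => //; first exact: expr1n.
  by rewrite mul1r.
apply: (Gop_eigen_multiples P fe) => //; first by rewrite sqrrN expr1n.
by rewrite tcrdN rmorphN rmorph1 mulN1r.
Qed.
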